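(* Fix one of the following two random orderings: (a) each edge receives an independent uniform arrival time in $[0,1]$ and edges are processed in increasing arrival time; (b) each vertex receives an independent uniform seed in $[0,1]$ and an edge with endpoint seeds $s,t$ is processed at time $\min\{s,t\}+\eta\max\{s,t\}$, where $0<\eta<\min$ of the distances between distinct seeds (lexicographic order). Let $\mathscr{T}$ be the random tree obtained from an edge $(u,v)$ between two special vertices by attaching to each of $u$ and $v$ an independent Galton–Watson tree with Poisson$(1)$ offspring (each vertex independently gets a Poisson$(1)$ number of new children), and let $\mathcal{M}_{\mathscr{T}}$ be the matching produced by the greedy algorithm on $\mathscr{T}$ (all edges present) with its edges processed in the chosen random ordering. Then there is a function $f$ with $\lim_{\varepsilon\to0}f(\varepsilon)=0$ such that for every $1$-regular input $(G,\boldsymbol{x})$ with $\max_{e}x_e\le\varepsilon$ and every edge $e$ of $G$, if $\mathcal{M}$ is the matching produced by the greedy CRS on $(G,\boldsymbol{x})$ with edges processed in the same random ordering, then $$\big|\Pr[e\in\mathcal{M}\mid X_e=1]-\Pr[(u,v)\in\mathcal{M}_{\mathscr{T}}]\big|\le f(\varepsilon).$$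
   Context: An input $(G,\boldsymbol{x})$ is a finite simple graph $G=(V,E)$ with $x_e\in[0,1]$; it is $1$-regular if $\sum_{e\in\partial(v)}x_e=1$ for each vertex $v$. Each edge is independently active ($X_e=1$) with probability $x_e$, independently of the ordering. The greedy CRS adds an arriving edge whenever it is active and both endpoints are unmatched; the greedy algorithm on $\mathscr{T}$ adds an arriving edge whenever both endpoints are unmatched. $\mathscr{T}$ is finite almost surely. *)

(* Defs.v *)
From HB Require Import structures.
From mathcomp Require Import all_boot all_order all_algebra finmap.
From mathcomp Require Import all_classical all_reals all_analysis.
Set Implicit Arguments.
Unset Strict Implicit.
Unset Printing Implicit Defensive.
Import Order.TTheory GRing.Theory Num.Theory.
Import numFieldNormedType.Exports.
Local Open Scope classical_set_scope.
Local Open Scope ring_scope.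

(* An edge is the finite set of its endpoints. *)

Section Greedy.
Context {R : realType} {V : choiceType}.
Implicit Types (e : {fset V}) (M : seq {fset V}) (E : {fset {fset V}}).

Definition is_matched M (v : V) : bool := has (fun e => v \in e) M.

Definition greedy_step (active : pred {fset V}) M e : seq {fset V} :=
  if active e && all (fun v => ~~ is_matched M v) e then e :: M else M.

(* Ties in [tau], a null event in the models below, are broken by the fixed
   enumeration of [E]. *)
Definition greedy_crs (tau : {fset V} -> R) active E : seq {fset V} :=
  foldl (greedy_step active) [::] (sort (fun e e' => tau e <= tau e') E).

Definition greedy (tau : {fset V} -> R) E : seq {fset V} :=
  greedy_crs tau predT E.

End Greedy.

Section Input.
Context {R : realType} {V : finType}.

Definition is_input (E : {fset {fset V}}) (x : {fset V} -> R) : Prop :=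
  (forall e, e \in E -> #|` e| = 2%N) /\
  (forall e, e \in E -> 0 <= x e <= 1).

Definition one_regular (E : {fset {fset V}}) (x : {fset V} -> R) : Prop :=
  forall v : V, \sum_(e <- E | v \in e) x e = 1.

End Input.

Section Probability.
Context {R : realType} {d : measure_display} {T : measurableType d}.

Definition cond_pr (P : probability T R) (A B : set T) : R :=
  fine (P (A `&` B)) / fine (P B).

Definition mutual_independence (P : probability T R) (I : choiceType)
    (D : set I) (F : I -> set_system T) : Prop :=
  forall (J : {fset I}) (A : I -> set T),
    [set` J] `<=` D -> (forall i, i \in J -> F i (A i)) ->
    P (\bigcap_(i in [set` J]) A i) = (\prod_(i <- J) fine (P (A i)))%:E.

(* Mutual independence of the union of two families, the first one indexed
   by [D1] and the second one by [D2]. *)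
Definition joint_independence (P : probability T R) (I1 I2 : choiceType)
    (D1 : set I1) (F1 : I1 -> set_system T)
    (D2 : set I2) (F2 : I2 -> set_system T) : Prop :=
  @mutual_independence P (I1 + I2)%type
    [set k | match k with inl i => D1 i | inr j => D2 j end]
    (fun k => match k with inl i => F1 i | inr j => F2 j end).

Definition uniform01 (P : probability T R) (U : {RV P >-> R}) : Prop :=
  (forall w, 0 <= U w <= 1) /\
  (forall B, measurable B ->
     distribution P U B = uniform_prob (@ltr01 R) B).

End Probability.

Variant ordering := edge_arrival | vertex_seeds.

(* [tau w e] is the time at which the edge [e] is processed in the outcome [w].
   [pE] is the set of the edges that can occur, [W w] is the vertex set in the
   outcome [w], and [F] (indexed by [D]) generates all the other randomness,
   of which the ordering has to be independent. In the second ordering [eta]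
   may depend on the outcome; nothing is required from it when [W w] is
   infinite, as there is then in general no positive lower bound on the
   distances between seeds. *)
Definition random_order {R : realType} {d : measure_display}
    {T : measurableType d} (o : ordering) (P : probability T R)
    (V I : choiceType) (D : set I) (F : I -> set_system T)
    (pE : set {fset V}) (W : T -> set V) (tau : T -> {fset V} -> R) : Prop :=
  match o with
  | edge_arrival =>
      exists U : {fset V} -> {RV P >-> R},
        [/\ forall e, pE e -> uniform01 (U e),
            joint_independence P D F
              pE (fun e => g_sigma_algebra_preimage (U e)) &
            forall w e, pE e -> tau w e = U e w]
  | vertex_seeds =>
      exists (S : V -> {RV P >-> R}) (eta : T -> R),
        [/\ forall v, uniform01 (S v),
            joint_independence P D F
              setT (fun v => g_sigma_algebra_preimage (S v)),
            forall w, finite_set (W w) -> 0 < eta w /\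
              (forall a b, W w a -> W w b -> S a w != S b w ->
                 eta w < `|S a w - S b w|) &
            forall w a b, pE [fset a; b]%fset ->
              tau w [fset a; b]%fset =
                Num.min (S a w) (S b w) + eta w * Num.max (S a w) (S b w)]
  end.

Definition crs_model {R : realType} {d : measure_display}
    {T : measurableType d} (o : ordering) (P : probability T R) (V : finType)
    (E : {fset {fset V}}) (x : {fset V} -> R) (X : {fset V} -> {RV P >-> bool})
    (tau : T -> {fset V} -> R) : Prop :=
  (forall e, e \in E -> P [set w | X e w = true] = (x e)%:E) /\
  random_order o P [set` E] (fun e => g_sigma_algebra_preimage (X e))
    [set` E] (fun=> setT) tau.

Section Tree.

(* Ulam-Harris labels, with the most recent generation first: [(b, [::])] is
   the special vertex [u] if [b] is true and [v] otherwise, and [(b, i :: s)]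
   is the [i]-th child of [(b, s)]. *)
Definition node : choiceType := (bool * seq nat)%type.

Definition root_edge : {fset node} :=
  [fset ((true, [::]) : node); ((false, [::]) : node)]%fset.

Fixpoint in_tree_rec (n : node -> nat) (b : bool) (s : seq nat) : bool :=
  match s with
  | [::] => true
  | i :: s' => (i < n (b, s'))%N && in_tree_rec n b s'
  end.

(* [n a] is the number of children of [a]. *)
Definition tree_vertices (n : node -> nat) : set node :=
  [set a | in_tree_rec n a.1 a.2].

Definition tree_edges (n : node -> nat) : set {fset node} :=
  [set e | e = root_edge \/
     exists b i s, tree_vertices n (b, i :: s) /\
       e = [fset ((b, s) : node); ((b, i :: s) : node)]%fset].

Definition possible_tree_edges : set {fset node} := \bigcup_n tree_edges n.

(* The greedy algorithm is run on finite trees; infinite trees form a null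
   event. *)
Definition root_edge_matched {R : realType} (n : node -> nat)
    (tau : {fset node} -> R) : Prop :=
  exists2 E : {fset {fset node}},
    [set` E] = tree_edges n & root_edge \in greedy tau E.

Definition tree_model {R : realType} {d : measure_display}
    {T : measurableType d} (o : ordering) (P : probability T R)
    (N : node -> {RV P >-> nat}) (tau : T -> {fset node} -> R) : Prop :=
  (forall a k, P [set w | N a w = k] = (poisson_pmf (1 : R) k)%:E) /\
  random_order o P setT (fun a => g_sigma_algebra_preimage (N a))
    possible_tree_edges (fun w => tree_vertices (fun a => N a w)) tau.

End Tree.

(* Main.v *)
Require Import Defs.
From HB Require Import structures.
From mathcomp Require Import all_boot all_order all_algebra finmap.
From mathcomp Require Import all_classical all_reals all_analysis.
From mathcomp Require Import ring lra zify.
Set Implicit Arguments.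
Unset Strict Implicit.
Unset Printing Implicit Defensive.
Import Order.TTheory GRing.Theory Num.Theory.
Import numFieldNormedType.Exports.
Local Open Scope classical_set_scope.
Local Open Scope ring_scope.

(* Explore the connected component of [e] in the graph of active edges, one
   vertex at a time. Since every vertex carries total mass 1 spread over edges
   of mass at most [eps], each explored vertex has, up to O(eps), a Poisson(1)
   number of new neighbours, all of them fresh (Le Cam). Hence for every finite
   tree the component is that tree with almost the probability given by the
   Galton-Watson tree. The latter is critical, hence almost surely finite, so
   finitely many trees carry almost all of the mass on both sides and no tail
   estimate on the graph is needed. Given the tree, whether the root edge is
   matched depends only on the relative order of the arrival times of its edges
   (or of the seeds of its vertices); rounding these down to multiples of 1/n
   makes them i.i.d. discrete, distinct with high probability, and of the same
   law in the graph and in the Galton-Watson tree.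

   Both explorations are decision trees querying independent variables. The
   value of such a tree bounds from below the probability of any event implied
   by its successful leaves; bounding "matched" and "not matched" in this way,
   with bounds adding up to almost 1, gives the two-sided estimate. *)

(** A decision tree can only bound from below: outcomes in which the exploration exceeds its limits,
    meets a cycle or sees two equal rounded labels are dropped, not analysed. The bound has to be
    the same number in the graph (up to an error) and in the Galton-Watson tree. This number is
    [explore], and to make it literally common a finite tree is described by pairs (parent, child)
    of indices in order of discovery; actual vertices enter only through the numbering. There is no
    circularity in the constants: the limits [K], [L] and the rounding [n] depend on the wanted
    accuracy alone, and the error in the graph is linear in the mass bound, with a coefficient that
    depends on [K] and [L] but not on [n], since the rounded labels have exactly the same law on
    both sides. The delicate point on the tree side is criticality: the generating function of
    Poisson(1) is tangent to the diagonal at 1, so each generation brings the extinction probability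
    closer to 1 only by a quadratic amount. *)

Lemma eq_in_sort (T : Type) (P : {pred T}) (le1 le2 : rel T) (s : seq T) :
  {in P &, le1 =2 le2} -> all P s -> sort le1 s = sort le2 s.
Proof.
move=> eq12 /all_sigP[s' ->]; rewrite !sort_map; congr map.
by congr sort; apply/funext => -[a Pa]; apply/funext => -[b Pb]; exact: eq12.
Qed.

(** * Greedy matching on a numbered tree, and its locality *)

Definition meets (p q : nat * nat) : bool :=
  [|| p.1 == q.1, p.1 == q.2, p.2 == q.1 | p.2 == q.2].

Definition pair_step (M : seq (nat * nat)) (q : nat * nat) :=
  if all (fun p => ~~ meets p q) M then q :: M else M.

Definition pair_greedy (le : rel (nat * nat)) (pe : seq (nat * nat)) :=
  foldl pair_step [::] (sort le pe).

(* The order in which index pairs are processed when [r] compares the labels.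
   With edge arrivals, the label of [(i, j)] is that of the edge from [j] to
   its parent and has number [j.-1]. *)
Definition pair_le (o : ordering) (r : rel nat) (q q' : nat * nat) : bool :=
  match o with
  | edge_arrival => r q.2.-1 q'.2.-1
  | vertex_seeds =>
      let lo q := if r q.1 q.2 then q.1 else q.2 in
      let hi q := if r q.1 q.2 then q.2 else q.1 in
      r (lo q) (lo q') && (~~ r (lo q') (lo q) || r (hi q) (hi q'))
  end.

Definition nlabels (o : ordering) (m : nat) : nat :=
  match o with edge_arrival => m.-1 | vertex_seeds => m end.

Definition pair_ok (m : nat) (q : nat * nat) : bool := (q.1 < q.2 < m)%N.

(** The conclusion stops at the second components because with edge arrivals the label of a pair
    remembers only the child; in a tree the child determines the pair. *)
Lemma pair_le_anti o m (r : rel nat) q q' :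
  (forall i j, (i < nlabels o m)%N -> (j < nlabels o m)%N ->
     r i j -> r j i -> i = j) ->
  pair_ok m q -> pair_ok m q' ->
  pair_le o r q q' && pair_le o r q' q -> q.2 = q'.2.
Proof.
case: q q' => [i j] [i' j'] /= ra; rewrite /pair_ok /= => ij ij'.
case: o ra => /= ra /andP[].
  move=> h1 h2; have e : j.-1 = j'.-1 by apply: ra => //; lia.
  lia.
have im : (i < m)%N by lia. have jm : (j < m)%N by lia.
have im' : (i' < m)%N by lia. have jm' : (j' < m)%N by lia.
set a := if r i j then i else j; set b := if r i j then j else i.
set a' := if r i' j' then i' else j'; set b' := if r i' j' then j' else i'.
have am : (a < m)%N by rewrite /a; case: ifP.
have bm : (b < m)%N by rewrite /b; case: ifP.
have am' : (a' < m)%N by rewrite /a'; case: ifP.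
have bm' : (b' < m)%N by rewrite /b'; case: ifP.
move=> /andP[h1 h2] /andP[h3 h4].
move: h2 h4; rewrite h1 h3 /= => h2 h4.
have := ra _ _ am am' h1 h3; have := ra _ _ bm bm' h2 h4.
by rewrite /a /b /a' /b'; case: ifP; case: ifP => _ _; lia.
Qed.

Lemma eq_pair_le o m (r r' : rel nat) :
  (forall i j, (i < nlabels o m)%N -> (j < nlabels o m)%N -> r i j = r' i j) ->
  forall q q', pair_ok m q -> pair_ok m q' -> pair_le o r q q' = pair_le o r' q q'.
Proof.
move=> rr [i j] [i' j'] /=; rewrite /pair_ok /= => ij ij'.
case: o rr => /= rr; first by rewrite rr //; lia.
have ->: r i j = r' i j by apply: rr; lia.
have ->: r i' j' = r' i' j' by apply: rr; lia.
by case: ifP; case: ifP => _ _; rewrite !rr //; lia.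
Qed.

Section Relabel.
Context {V : choiceType}.
Implicit Types (phi : nat -> V) (M : seq {fset V}).

Definition edge_of phi (q : nat * nat) : {fset V} := [fset phi q.1; phi q.2]%fset.

Lemma is_matched_edge_of phi (M : seq (nat * nat)) v :
  is_matched (map (edge_of phi) M) v =
  has (fun q => (v == phi q.1) || (v == phi q.2)) M.
Proof. by rewrite /is_matched has_map; apply: eq_has => q /=; rewrite !inE. Qed.

Lemma foldl_greedy_edge_of phi m (s M : seq (nat * nat)) :
  (forall i j, (i < m)%N -> (j < m)%N -> phi i = phi j -> i = j) ->
  all (pair_ok m) s -> all (pair_ok m) M ->
  foldl (greedy_step predT) (map (edge_of phi) M) (map (edge_of phi) s) =
  map (edge_of phi) (foldl pair_step M s).
Proof.
move=> inj; elim: s M => //= q s IH M /andP[qm sm] Mm.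
suff -> : greedy_step predT (map (edge_of phi) M) (edge_of phi q) =
          map (edge_of phi) (pair_step M q).
  by apply: IH => //; rewrite /pair_step; case: ifP => //= _; rewrite qm.
rewrite /greedy_step /pair_step /=.
have qq : (q.1 < m)%N /\ (q.2 < m)%N by move: qm; rewrite /pair_ok; lia.
suff -> : all (fun v => ~~ is_matched (map (edge_of phi) M) v) (edge_of phi q) =
          all (fun p => ~~ meets p q) M by case: ifP.
have key v : v \in edge_of phi q = (v == phi q.1) || (v == phi q.2).
  by rewrite !inE.
have phiE i (p : nat * nat) : (i < m)%N -> p \in M ->
    (phi i == phi p.1) || (phi i == phi p.2) = (i == p.1) || (i == p.2).
  move=> im pM; have := allP Mm _ pM; rewrite /pair_ok => pm.
  by congr orb; apply/eqP/eqP => [e|-> //]; apply: inj e; lia.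
apply/allP/allP => [h p pM|h v].
- have := h (phi q.1); rewrite key eqxx => /(_ erefl).
  have := h (phi q.2); rewrite key eqxx orbT => /(_ erefl).
  rewrite !is_matched_edge_of => /hasPn /(_ _ pM) h2 /hasPn /(_ _ pM) h1.
  move: h1 h2; rewrite !phiE //; try by case: qq.
  by rewrite /meets; lia.
rewrite key is_matched_edge_of => vq; apply/hasPn => p pM.
have := h _ pM; rewrite /meets.
by case/orP: vq => /eqP ->; rewrite phiE //; try (by case: qq); lia.
Qed.

(** [C] is a union of components of the active graph. An active edge outside [C] shares no vertex
    with an edge in [C], so it never blocks one, and filtering by [C] commutes with every greedy
    step. *)
Lemma foldl_greedy_closed (act C : pred {fset V}) (s M : seq {fset V}) :
  (forall f, C f -> act f) ->
  (forall f g v, f \in M ++ s -> act f -> C g -> v \in f -> v \in g -> C f) ->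
  all act M ->
  [seq f <- foldl (greedy_step act) M s | C f] =
  foldl (greedy_step predT) [seq f <- M | C f] [seq f <- s | C f].
Proof.
move=> Cact; elim: s M => //= f s IH M closed Mact.
have stepE : [seq g <- greedy_step act M f | C g] =
    if C f then greedy_step predT [seq g <- M | C g] f else [seq g <- M | C g].
  rewrite /greedy_step /=; case: (boolP (C f)) => Cf; last first.
    by case: ifP => //= _; rewrite (negbTE Cf).
  rewrite (Cact _ Cf) /=.
  have -> : all (fun v => ~~ is_matched M v) f =
            all (fun v => ~~ is_matched [seq g <- M | C g] v) f.
    apply: eq_in_all => v vf; congr negb; apply/hasP/hasP => -[g].
      move=> gM vg; exists g => //; rewrite mem_filter gM andbT.
      apply: (closed g f v) => //; first by rewrite mem_cat gM.
      by rewrite (allP Mact).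
    by rewrite mem_filter => /andP[_ gM] vg; exists g.
  by case: ifP => //= _; rewrite Cf.
rewrite IH.
- by rewrite stepE; case: ifP.
- move=> f' g v; rewrite mem_cat => f's; apply: closed.
  rewrite mem_cat inE; case/orP: f's => [|->]; last by rewrite !orbT.
  by rewrite /greedy_step; case: ifP => _; rewrite ?inE; [case/orP|] => ->; rewrite ?orbT.
- rewrite /greedy_step; case: ifP => //= /andP[-> _] //.
Qed.

Lemma edge_of_inj phi m :
  (forall i j, (i < m)%N -> (j < m)%N -> phi i = phi j -> i = j) -> {in pair_ok m &, injective (edge_of phi)}.
Proof.
move=> inj [i j] [i' j']; rewrite !unfold_in /pair_ok /= => ij ij' e.
have e1 : phi i \in edge_of phi (i', j') by rewrite -e !inE eqxx.
have e2 : phi j \in edge_of phi (i', j') by rewrite -e !inE eqxx orbT.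
have h a b : (a < m)%N -> (b < m)%N -> (phi a == phi b) = (a == b).
  by move=> am bm; apply/eqP/eqP => [|-> //]; apply: inj.
move: e1 e2; rewrite !inE /= !h; try lia.
by move=> e1 e2; congr pair; lia.
Qed.

Lemma greedy_component {R : realType} (tau : {fset V} -> R)
    (act : pred {fset V}) (E : {fset {fset V}}) o (r : rel nat) phi m
    (pe : seq (nat * nat)) (q : nat * nat) :
  (forall i j, (i < m)%N -> (j < m)%N -> phi i = phi j -> i = j) ->
  all (pair_ok m) pe -> uniq (map snd pe) ->
  (forall i j, (i < nlabels o m)%N -> (j < nlabels o m)%N ->
     r i j -> r j i -> i = j) ->
  (forall p, p \in pe -> edge_of phi p \in E /\ act (edge_of phi p)) ->
  (forall f p v, f \in E -> act f -> p \in pe -> v \in f ->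
     v \in edge_of phi p -> f \in map (edge_of phi) pe) ->
  (forall p p', p \in pe -> p' \in pe ->
     (tau (edge_of phi p) <= tau (edge_of phi p')) = pair_le o r p p') ->
  q \in pe ->
  (edge_of phi q \in greedy_crs tau act E) = (q \in pair_greedy (pair_le o r) pe).
Proof.
move=> inj pem peu ra peE closed tauE qpe.
pose C f := f \in map (edge_of phi) pe.
have Cq : C (edge_of phi q) by apply: map_f.
rewrite /greedy_crs; set s := sort _ E.
transitivity (edge_of phi q \in [seq f <- foldl (greedy_step act) [::] s | C f]).
  by rewrite mem_filter Cq.
rewrite foldl_greedy_closed //=; last 2 first.
- by move=> f /mapP[p ppe ->]; case: (peE _ ppe).
- move=> f g v; rewrite mem_sort => fE af /mapP[p ppe ->] vf vp.
  exact: (closed _ p v).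
pose le e e' := tau e <= tau e'.
have le_total : total le by move=> a b; exact: le_total.
have le_trans : transitive le by move=> a b c; exact: le_trans.
have pu : uniq (map (edge_of phi) pe).
  rewrite map_inj_in_uniq; first by apply: (map_uniq peu).
  by move=> a b ape bpe; apply: (edge_of_inj inj); exact: (allP pem).
have snd_inj : {in pe &, forall a b, a.2 = b.2 -> a = b}.
  move=> a b ape bpe e; have [i i_lt ai] := nthP a ape; have [j j_lt bj] := nthP a bpe.
  suff -> : a = b by [].
  rewrite -ai -bj; congr nth; apply/eqP.
  rewrite -(nth_uniq 0%N _ _ peu) ?size_map // !(nth_map a) //.
  by rewrite ai bj e.
have -> : [seq f <- s | C f] = map (edge_of phi) (sort (pair_le o r) pe).
  rewrite filter_sort //.
  transitivity (sort le (map (edge_of phi) pe)).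
    (* The two lists hold the same edges in different enumerations; they sort to the same list
       because [pair_le_anti] excludes ties. *)
    apply/esym/perm_sort_inP.
    - by move=> a b _ _; exact: le_total.
    - by move=> a b c _ _ _; exact: le_trans.
    - move=> a b /mapP[p ppe ->] /mapP[p' ppe' ->].
      rewrite /le !tauE // => /(pair_le_anti ra) h2; congr edge_of; apply: snd_inj => //.
      by apply: h2; apply: (allP pem).
    apply: uniq_perm => //; first by rewrite filter_uniq // fset_uniq.
    move=> f; rewrite mem_filter /C; apply/idP/andP => [fp|[]//].
    by split => //; case/mapP: fp => p ppe ->; case: (peE _ ppe).
  rewrite sort_map; congr map.
  apply: (@eq_in_sort _ (mem pe)); last by apply/allP.
  by move=> a b ape bpe; rewrite /relpre /= /le tauE.
have sm : all (pair_ok m) (sort (pair_le o r) pe) by rewrite all_sort.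
rewrite (@foldl_greedy_edge_of phi m _ [::] inj) //.
have subM : forall s' (M : seq (nat * nat)), {subset foldl pair_step M s' <= M ++ s'}.
  elim=> [|a s' IH] M b /=; first by rewrite cats0.
  move=> /IH; rewrite !mem_cat inE /pair_step; case: ifP => _; last first.
    by case/orP => ->; rewrite ?orbT.
  by rewrite inE; case/orP => [/orP[]|] ->; rewrite ?orbT.
apply/mapP/idP => [[q' q'g]|]; last by move=> h; exists q.
have q'pe : q' \in pe by have := subM _ _ _ q'g; rewrite mem_sort.
by move/(edge_of_inj inj) => -> //; exact: (allP pem).
Qed.

End Relabel.

(** * Decision trees on independent variables *)

Inductive dtree (I : Type) : Type :=
  | Leaf of bool
  | Query of I & seq nat & (nat -> dtree I).
Arguments Leaf {I}.

Section DecisionTree.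
Context {R : realType} {I : choiceType}.

(** A run fails at [Leaf false] or on an answer that the query does not list; both contribute 0. For
    independent variables with laws [mu] and no repeated query, this is the probability of
    success. *)
Fixpoint dval (mu : I -> nat -> R) (t : dtree I) : R :=
  match t with
  | Leaf b => b%:R
  | Query i s k => \sum_(a <- s) mu i a * dval mu (k a)
  end.

Fixpoint drun {T : Type} (ev : I -> nat -> set T) (t : dtree I) (w : T) : Prop :=
  match t with
  | Leaf b => b
  | Query i s k => exists2 a, a \in s & ev i a w /\ drun ev (k a) w
  end.

(** No variable is queried twice along a branch: this is what allows independence to be applied at
    each query. *)
Fixpoint dfresh (S : set I) (t : dtree I) : Prop :=
  match t with
  | Leaf _ => True
  | Query i s k =>
      [/\ S i, uniq s & forall a, a \in s -> dfresh (S `\ i) (k a)]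
  end.

Lemma dfreshS (S S' : set I) t : S `<=` S' -> dfresh S t -> dfresh S' t.
Proof.
elim: t S S' => //= i s k IH S S' SS' [Si us h]; split => //; first exact: SS'.
by move=> a /h; apply: IH => j [/SS' ? ?].
Qed.

Context {d : measure_display} {T : measurableType d} (P : probability T R).

Lemma fine_probability_ge0 A : 0 <= fine (P A).
Proof. by rewrite fine_ge0. Qed.

Lemma fineK_probability A : measurable A -> ((fine (P A))%:E = P A)%E.
Proof. by move=> mA; rewrite fineK // fin_num_measure. Qed.

Lemma le_fine_probability A B : measurable A -> measurable B -> A `<=` B ->
  fine (P A) <= fine (P B).
Proof.
move=> mA mB AB; rewrite -lee_fin !fineK_probability //.
by apply: le_measure => //; rewrite inE.
Qed.

Lemma fine_probability_split A B : measurable A -> measurable B ->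
  fine (P A) = fine (P (A `\` B)) + fine (P (A `&` B)).
Proof.
move=> mA mB; apply: EFin_inj; rewrite EFinD !fineK_probability //.
- exact: measureDI.
- exact: measurableI.
- exact: measurableD.
Qed.

Lemma sum_probability_le (e : nat -> set T) B (s : seq nat) :
  measurable B -> (forall a, measurable (e a)) ->
  (forall a b w, e a w -> e b w -> a = b) -> uniq s ->
  \sum_(a <- s) fine (P (B `&` e a)) <= fine (P B).
Proof.
move=> mB me dis; elim: s B mB => [|a s IH] B mB /=.
  by rewrite big_nil fine_probability_ge0.
move=> /andP[as_ us]; rewrite big_cons (fine_probability_split mB (me a)) addrC.
apply: lerD => //; apply: le_trans (IH (B `\` e a) _ us); last exact: measurableD.
rewrite big_seq [leRHS]big_seq; apply: ler_sum => b bs.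
rewrite le_eqVlt; apply/orP; left; apply/eqP; congr (fine (P _)).
apply/seteqP; split => w /= [Bw ebw]; last by case: Bw.
split => //; split => // eaw; move: as_; rewrite (dis _ _ _ eaw ebw).
by rewrite bs.
Qed.

Variables (D : set I) (F : I -> set_system T) (ev : I -> nat -> set T).
Hypothesis indep : mutual_independence P D F.
Hypothesis F_measurable : forall i A, D i -> F i A -> measurable A.
Hypothesis ev_in : forall i a, D i -> F i (ev i a).
Hypothesis ev_disjoint : forall i a b w, D i -> ev i a w -> ev i b w -> a = b.

Let mu i a := fine (P (ev i a)).

(** [J] and [A] record the answers obtained so far. A fresh query lies outside [J], so independence
    multiplies its probability into the product, and the events of distinct answers are disjoint. At
    a successful leaf the recorded answers imply [M]. *)
Lemma dtree_lower_bound (M : set T) t : measurable M ->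
  forall (S : set I) (J : {fset I}) (A : I -> set T),
  S `<=` D -> [set` J] `<=` D -> (forall i, i \in J -> ~ S i) ->
  (forall i, i \in J -> F i (A i)) -> dfresh S t ->
  (forall w, (forall i, i \in J -> A i w) -> drun ev t w -> M w) ->
  (\prod_(i <- J) fine (P (A i))) * dval mu t <=
  fine (P (M `&` \bigcap_(i in [set` J]) A i)).
Proof.
move=> mM; have mcap (J : {fset I}) A : [set` J] `<=` D ->
    (forall i, i \in J -> F i (A i)) -> measurable (\bigcap_(i in [set` J]) A i).
  move=> JD AF; apply: fin_bigcap_measurable; first exact: finite_fset.
  by move=> i /= iJ; apply: (@F_measurable i); [exact: JD|exact: AF].
elim: t => [b|i s k IH] S J A SD JD JS AF /=.
  move=> _ h; case: b h => /= h; last by rewrite mulr0 fine_probability_ge0.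
  rewrite mulr1 (_ : _ `&` _ = \bigcap_(i in [set` J]) A i); first by rewrite indep.
  by apply/seteqP; split => [w []//|w Aw]; split => //; apply: h.
move=> [Si us fr] h; have Di := SD _ Si.
have iJ : i \notin J by apply/negP => /JS.
set B := _ `&` _.
have mB : measurable B by apply: measurableI => //; apply: mcap.
apply: le_trans (sum_probability_le mB _ _ us); last 2 first.
- by move=> a; apply: (F_measurable Di); apply: ev_in.
- by move=> a b w; exact: ev_disjoint.
rewrite mulr_sumr big_seq [leRHS]big_seq; apply: ler_sum => a as_.
pose A' j := if j == i then ev i a else A j.
have A'J j : j \in J -> A' j = A j.
  by rewrite /A'; case: eqP => // -> iJ'; rewrite iJ' in iJ.
have -> : B `&` ev i a = M `&` \bigcap_(j in [set` (i |` J)%fset]) A' j.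
  apply/seteqP; split => w /=.
    move=> [[Mw Aw] ew]; split => // j /=; rewrite !inE => /orP[/eqP ->|jJ].
      by rewrite /A' eqxx.
    by rewrite A'J //; apply: Aw.
  move=> [Mw Aw]; split; last by have := Aw i; rewrite /A' eqxx /= !inE eqxx; apply.
  split => // j /= jJ; rewrite -A'J //; apply: Aw; rewrite /= !inE jJ orbT //.
have prodE : \prod_(j <- (i |` J)%fset) fine (P (A' j)) =
    mu i a * \prod_(j <- J) fine (P (A j)).
  rewrite big_fsetU1 //= {1}/A' eqxx; congr (_ * _).
  by rewrite big_seq [RHS]big_seq; apply: eq_bigr => j jJ; rewrite A'J.
have := IH a (S `\ i) (i |` J)%fset A'; rewrite prodE => IHa.
rewrite mulrA [X in X * _]mulrC; apply: IHa.
- by move=> j [/SD].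
- by move=> j /=; rewrite !inE => /orP[/eqP -> //|/JD].
- by move=> j; rewrite !inE => /orP[/eqP -> [_ []//]|/JS jS [/jS]].
- move=> j; rewrite !inE => /orP[/eqP ->|jJ]; first by rewrite /A' eqxx; apply: ev_in.
  by rewrite A'J //; apply: AF.
- exact: fr.
- move=> w Aw rw; apply: h.
    by move=> j jJ; rewrite -A'J //; apply: Aw; rewrite !inE jJ orbT.
  exists a => //; split => //.
  by have := Aw i; rewrite /A' eqxx !inE eqxx; apply.
Qed.

End DecisionTree.

(** * The truncated critical Galton-Watson exploration *)

Section PoissonExploration.
Context {R : realType}.

Local Notation pois k := (poisson_pmf (1 : R) k).

(* Expected value of [rho] on the final state of an exploration in which every
   vertex of the stack [st] has a Poisson(1) number of children, the outcomes
   with more than [L] steps or more than [K] children of a vertex being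
   discarded. There are [m] vertices so far, and [pe] lists their edges. *)
Fixpoint explore (rho : nat -> seq (nat * nat) -> R) (K L m : nat)
    (st : seq nat) (pe : seq (nat * nat)) : R :=
  match st with
  | [::] => rho m pe
  | p :: st' =>
      match L with
      | 0%N => 0
      | L'.+1 => \sum_(0 <= k < K.+1) pois k *
          explore rho K L' (m + k) (iota m k ++ st')
            (pe ++ [seq (p, j) | j <- iota m k])
      end
  end.

(** The value of [explore] for [rho] constantly 1, which depends on the stack only through its size
    [z]. *)
Fixpoint mass (K L z : nat) : R :=
  match z with
  | 0%N => 1
  | z'.+1 =>
      match L with
      | 0%N => 0
      | L'.+1 => \sum_(0 <= k < K.+1) pois k * mass K L' (k + z')
      end
  end.

Lemma poisson1E k : pois k = expR (-1) / k`!%:R.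
Proof. by rewrite /poisson_pmf ltr01 expr1n mul1r mulrC. Qed.

Lemma series_exp_coeff_le (q : R) n : 0 <= q ->
  \sum_(0 <= k < n) q ^+ k / k`!%:R <= expR q.
Proof.
move=> q0; rewrite /expR; apply: (nondecreasing_cvgn_le (u_ := series (exp_coeff q))).
  apply/nondecreasing_seqP => i; rewrite /series /= big_nat_recr //= lerDl.
  exact: exp_coeff_ge0.
exact: is_cvg_series_exp_coeff.
Qed.

Lemma sum_poisson_le1 n : \sum_(0 <= k < n) pois k <= 1.
Proof.
under eq_bigr do rewrite poisson1E.
rewrite -mulr_sumr -[leRHS](mulVf (lt0r_neq0 (expR_gt0 (1 : R)))) -expRN.
rewrite ler_wpM2l // ?expR_ge0 //.
apply: le_trans (series_exp_coeff_le n ler01); apply: ler_sum => k _.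
by rewrite expr1n mul1r.
Qed.

Lemma explore_bounds rho K L m st pe : (forall m pe, 0 <= rho m pe <= 1) ->
  0 <= explore rho K L m st pe <= 1.
Proof.
move=> h; elim: L m st pe => [|L IH] m [|p st] pe //=; try exact: h.
  by rewrite lexx ler01.
apply/andP; split.
  apply: sumr_ge0 => k _; rewrite mulr_ge0 ?poisson_pmf_ge0 //.
  by case/andP: (IH (m + k)%N (iota m k ++ st) (pe ++ [seq (p, j) | j <- iota m k])).
apply: le_trans (sum_poisson_le1 K.+1); apply: ler_sum => k _.
rewrite ler_piMr ?poisson_pmf_ge0 //.
by case/andP: (IH (m + k)%N (iota m k ++ st) (pe ++ [seq (p, j) | j <- iota m k])).
Qed.

Lemma exploreD rho rho' K L m st pe :
  explore rho K L m st pe + explore rho' K L m st pe =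
  explore (fun m pe => rho m pe + rho' m pe) K L m st pe.
Proof.
elim: L m st pe => [|L IH] m [|p st] pe //=; first by rewrite addr0.
by rewrite -big_split /=; apply: eq_bigr => k _; rewrite -mulrDr IH.
Qed.

Lemma explore_ge_mass rho K L m st pe (de : R) Mx : 0 <= de ->
  (forall m pe, (m <= Mx)%N -> 1 - de <= rho m pe) -> (m + K * L <= Mx)%N ->
  mass K L (size st) - de <= explore rho K L m st pe.
Proof.
move=> de0 h; elim: L m st pe => [|L IH] m [|p st] pe /= mL.
- by apply: h; lia.
- by rewrite sub0r oppr_le0.
- by apply: h; lia.
apply: (@le_trans _ _ (\sum_(0 <= k < K.+1) pois k * (mass K L (k + size st) - de))).
  under [leRHS]eq_bigr do rewrite mulrBr.
  rewrite sumrB lerD2l lerN2 -mulr_suml ler_piMl //.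
  exact: sum_poisson_le1.
apply: ler_sum_nat => k /= kK.
rewrite ler_wpM2l ?poisson_pmf_ge0 //.
have := IH (m + k)%N (iota m k ++ st) (pe ++ [seq (p, j) | j <- iota m k]).
rewrite size_cat size_iota; apply.
rewrite mulnS in mL; lia.
Qed.

Lemma mass_ge0 K L z : 0 <= mass K L z.
Proof.
elim: L z => [|L IH] [|z] //=; apply: sumr_ge0 => k _.
by rewrite mulr_ge0 ?poisson_pmf_ge0.
Qed.

Lemma mass_mono K L L' z : (L <= L')%N -> mass K L z <= mass K L' z.
Proof.
elim: L L' z => [|L IH] L' [|z].
- by case: L'.
- by move=> _ /=; exact: mass_ge0.
- by case: L'.
case: L' => // L' LL' /=; apply: ler_sum => k _.
by rewrite ler_wpM2l ?poisson_pmf_ge0 // IH.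
Qed.

(** Iterates of the truncated generating function from 0: the probability that the descent of one
    vertex has at most [h] generations, that vertex included, and at most [K] children
    everywhere. *)
Fixpoint extinct (K h : nat) : R :=
  match h with
  | 0%N => 0
  | h'.+1 => \sum_(0 <= k < K.+1) pois k * extinct K h' ^+ k
  end.

Lemma extinct_ge0 K h : 0 <= extinct K h.
Proof.
elim: h => //= h IH; apply: sumr_ge0 => k _.
by rewrite mulr_ge0 ?poisson_pmf_ge0 // exprn_ge0.
Qed.

Lemma extinct_le1 K h : extinct K h <= 1.
Proof.
elim: h => [|h IH] /=; first exact: ler01.
apply: le_trans (sum_poisson_le1 K.+1); apply: ler_sum => k _.
by rewrite ler_piMr ?poisson_pmf_ge0 // exprn_ile1 // extinct_ge0.
Qed.

(** Bounded height and bounded degree bound the number of vertices, hence the number of exploration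
    steps: [Lh] steps suffice to clear the first vertex of the stack with all its descent, and [L]
    steps remain for the others. *)
Lemma extinct_mass K h : exists Lh, forall L z,
  extinct K h * mass K L z <= mass K (L + Lh) z.+1.
Proof.
elim: h => [|h [Lh IH]]; first by exists 0%N => L z; rewrite mul0r mass_ge0.
(* One step for the vertex itself and [Lh] for each of its at most [K] children. *)
exists (K * Lh).+1 => L z; rewrite addnS /= mulr_suml.
have step k L' : extinct K h ^+ k * mass K L' z <= mass K (L' + k * Lh) (k + z).
  elim: k => [|k IHk]; first by rewrite mul0n addn0 add0n mul1r.
  rewrite exprS -mulrA mulSn addnCA addnC addSn; apply: le_trans (IH _ _).
  by rewrite ler_wpM2l ?extinct_ge0.
apply: ler_sum_nat => k /= kK.
rewrite -mulrA ler_wpM2l ?poisson_pmf_ge0 //; apply: le_trans (step _ _) _.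
by apply: mass_mono; rewrite leq_add2l leq_mul2r; lia.
Qed.

(** The tails of the two exponential series compare term by term, so the difference [u] of the
    partial sums is nondecreasing and stays below its limit. *)
Lemma exp_tail_le (q : R) n : 0 <= q <= 1 ->
  expR q - \sum_(0 <= k < n) q ^+ k / k`!%:R <=
  expR 1 - \sum_(0 <= k < n) k`!%:R^-1.
Proof.
move=> /andP[q0 q1].
pose u := (series (exp_coeff 1) - series (exp_coeff q) : R ^nat).
have cu : u @ \oo --> expR 1 - expR q.
  by apply: cvgB; exact: is_cvg_series_exp_coeff.
have ndu : nondecreasing_seq u.
  apply/nondecreasing_seqP => i; rewrite /u !fctE /series /= !big_nat_recr //=.
  rewrite opprD addrACA lerDl subr_ge0 /exp_coeff /=.
  by rewrite ler_wpM2r ?invr_ge0 ?ler0n // expr1n exprn_ile1.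
have := nondecreasing_cvgn_le ndu (cvgP _ cu) n; rewrite (cvg_lim _ cu) //.
rewrite /u !fctE /series /=.
have -> : \sum_(0 <= k < n) exp_coeff (1 : R) k = \sum_(0 <= k < n) k`!%:R^-1.
  by apply: eq_bigr => k _; rewrite /exp_coeff /= expr1n mul1r.
rewrite /exp_coeff /=; lra.
Qed.

(** Up to the truncated tail the generating function at [q] is exp(-(1 - q)), which is at least (1 -
    (1 - q)/2)^2, that is [q] plus the square of (1 - q)/2. The linear terms cancel by criticality,
    and the quadratic gain is what remains. *)
Lemma extinct_step K h (q := extinct K h) :
  q + (1 - q) ^+ 2 / 4 - (1 - \sum_(0 <= k < K.+1) pois k) <= extinct K h.+1.
Proof.
rewrite /= -/q.
have q01 : 0 <= q <= 1 by rewrite extinct_ge0 extinct_le1.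
have e1 : expR (-1) * expR 1 = 1 :> R by rewrite -expRD addNr expR0.
have -> : \sum_(0 <= k < K.+1) pois k * q ^+ k =
          expR (-1) * \sum_(0 <= k < K.+1) q ^+ k / k`!%:R.
  by rewrite mulr_sumr; apply: eq_bigr => k _; rewrite poisson1E -mulrA [_^-1 * _]mulrC.
have -> : \sum_(0 <= k < K.+1) pois k = expR (-1) * \sum_(0 <= k < K.+1) k`!%:R^-1.
  by rewrite mulr_sumr; apply: eq_bigr => k _; rewrite poisson1E.
have := exp_tail_le K.+1 q01.
rewrite -(ler_pM2l (expR_gt0 (-1 : R))) !mulrBr e1 -expRD => tl.
have sq : (1 - (1 - q) / 2) ^+ 2 <= expR (-1 + q).
  have -> : -1 + q = (- ((1 - q) / 2)) + (- ((1 - q) / 2)) by lra.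
  rewrite expRD expr2.
  have g : 1 - (1 - q) / 2 <= expR (- ((1 - q) / 2)) by exact: expR_ge1Dx.
  apply: ler_pM => //; lra.
have e2 : (1 - (1 - q) / 2) ^+ 2 = q + (1 - q) ^+ 2 / 4 by field.
rewrite e2 in sq; lra.
Qed.

(** [K] is fixed first, so that the truncation costs at most [c], half of the gain [de ^+ 2 / 4]
    available as long as [1 - q] exceeds [de]. Each generation then gains at least [c], which cannot
    go on beyond [c^-1] generations. *)
Lemma extinct_near1 (de : R) : 0 < de -> exists K h, 1 - de <= extinct K h.
Proof.
move=> de0; pose c := de ^+ 2 / 8.
have c0 : 0 < c by rewrite /c divr_gt0 // exprn_gt0.
have [K tl] : exists K, 1 - \sum_(0 <= k < K.+1) pois k <= c.
  have cvg1 : series (exp_coeff (1 : R)) @ \oo --> expR (1 : R).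
    exact: is_cvg_series_exp_coeff.
  have /cvgrPdist_le/(_ c c0)[K _ /(_ K.+1)/(_ (leqnSn K))] := cvg1.
  rewrite /series /= => hK; exists K.
  have -> : \sum_(0 <= k < K.+1) pois k =
      expR (-1) * \sum_(0 <= k < K.+1) exp_coeff (1 : R) k.
    rewrite mulr_sumr; apply: eq_bigr => k _.
    by rewrite poisson1E /exp_coeff /= expr1n mul1r.
  have e1 : expR (-1) * expR 1 = 1 :> R by rewrite -expRD addNr expR0.
  rewrite -[X in X - _]e1 -mulrBr.
  have h1 := le_trans (ler_norm _) hK.
  have h2 : expR (-1) <= 1 :> R by rewrite -[leRHS]expR0 ler_expR; lra.
  apply: (@le_trans _ _ (expR (-1) * c)).
    by rewrite ler_wpM2l // expR_ge0.
  by rewrite ler_piMl // ltW.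
exists K; apply: contrapT => /forallNP no.
have grow h : h%:R * c <= extinct K h.
  elim: h => [|h IH]; first by rewrite mul0r.
  have /negP := no h; rewrite -ltNge => lth.
  have := extinct_step K h.
  have : de ^+ 2 <= (1 - extinct K h) ^+ 2.
    by rewrite ler_pXn2r // ?nnegrE; lra.
  have -> : h.+1%:R = h%:R + 1 :> R by rewrite natr1.
  rewrite mulrDl mul1r.
  rewrite /c in tl IH *; lra.
have [h hc] : exists h, 1 < h%:R * c.
  have [h hh] : exists h : nat, c^-1 < h%:R.
    by exists (Num.bound c^-1); rewrite archi_boundP // invr_ge0 ltW.
  by exists h; rewrite -ltr_pdivrMr // div1r.
have := grow h; have := extinct_le1 K h; lra.
Qed.

(** The initial stack holds the two endpoints of the root edge; each descent dies out with
    probability at least [1 - de / 2]. *)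
Lemma mass_near1 (de : R) : 0 < de -> exists K L, 1 - de <= mass K L 2.
Proof.
move=> de0; have [K [h hK]] : exists K h, 1 - de / 2 <= extinct K h.
  by apply: extinct_near1; rewrite divr_gt0.
have [Lh H] := extinct_mass K h.
exists K, (0 + Lh + Lh)%N.
apply: le_trans (H _ _); have := H 0%N 0%N; rewrite /= mulr1 => h1.
have e0 := extinct_ge0 K h; have e1 := extinct_le1 K h.
apply: (@le_trans _ _ (extinct K h * extinct K h)); last exact: ler_wpM2l.
by nra.
Qed.

End PoissonExploration.

(** * Rounded labels and their collisions *)

Section Labels.
Context {R : realType}.

Fixpoint label_tree {I : Type} (lab : nat -> I) (leaf : seq nat -> bool)
    (n c : nat) (v : seq nat) : dtree I :=
  match c with
  | 0%N => Leaf (leaf v)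
  | c'.+1 => Query (lab (size v)) (index_iota 0 n)
               (fun a => label_tree lab leaf n c' (rcons v a))
  end.

Fixpoint label_val (leaf : seq nat -> bool) (n c : nat) (v : seq nat) : R :=
  match c with
  | 0%N => (leaf v)%:R
  | c'.+1 => \sum_(0 <= a < n) n%:R^-1 * label_val leaf n c' (rcons v a)
  end.

Lemma dval_label_tree {I : choiceType} (mu : I -> nat -> R) lab leaf n c v :
  (forall i a, (i < size v + c)%N -> (a < n)%N -> mu (lab i) a = n%:R^-1) ->
  dval mu (label_tree lab leaf n c v) = label_val leaf n c v.
Proof.
elim: c v => //= c IH v h; apply: eq_big_nat => a /= an.
rewrite h //; last by lia.
by rewrite IH // => i b; rewrite size_rcons => ic; apply: h; lia.
Qed.

Lemma dfresh_label_tree {I : choiceType} (S : set I) lab leaf n c v :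
  (forall i, (size v <= i < size v + c)%N -> S (lab i)) ->
  (forall i j, (size v <= i < size v + c)%N -> (size v <= j < size v + c)%N ->
     lab i = lab j -> i = j) ->
  dfresh S (label_tree lab leaf n c v).
Proof.
elim: c v S => //= c IH v S hS inj; split.
- by apply: hS; lia.
- by rewrite iota_uniq.
move=> a _; apply: IH => [i|i j]; rewrite !size_rcons => ir.
  split; first by apply: hS; lia.
  by move=> /= e; have := inj i (size v) _ _ e; lia.
by move=> jr; apply: inj; lia.
Qed.

Lemma drun_label_tree {I : choiceType} {T : Type} (ev : I -> nat -> set T) lab leaf
    n c v w :
  drun ev (label_tree lab leaf n c v) w ->
  (forall i, (i < size v)%N -> ev (lab i) (nth 0%N v i) w) ->
  exists v', [/\ size v' = (size v + c)%N, leaf v' &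
    forall i, (i < size v')%N -> ev (lab i) (nth 0%N v' i) w].
Proof.
elim: c v => [|c IH] v /=; first by move=> lv h; exists v; rewrite addn0.
move=> [a _ [ea /IH h]] hv; case: h => [i|v' [sv' lv' h]].
  rewrite size_rcons nth_rcons ltnS leq_eqVlt => /orP[/eqP ->|iv].
    by rewrite ltnn eqxx.
  by rewrite iv; apply: hv.
by exists v'; split => //; rewrite sv' size_rcons addSnnS.
Qed.

Lemma label_val_bounds leaf n c v : 0 <= label_val leaf n c v <= 1.
Proof.
elim: c v => [|c IH] v /=; first by case: (leaf v); rewrite ?lexx ?ler01.
apply/andP; split.
  apply: sumr_ge0 => a _; rewrite mulr_ge0 // ?invr_ge0 ?ler0n //.
  by case/andP: (IH (rcons v a)).
apply: (@le_trans _ _ (\sum_(0 <= a < n) n%:R^-1)).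
  apply: ler_sum => a _; rewrite ler_piMr // ?invr_ge0 ?ler0n //.
  by case/andP: (IH (rcons v a)).
rewrite sumr_const_nat subn0; case: n {IH} => [|n]; first by rewrite mulr0n ler01.
by rewrite -[leLHS]mulr_natr mulVf // pnatr_eq0.
Qed.

Lemma label_valD (leaf leaf' leaf'' : seq nat -> bool) n c v :
  (forall v, (leaf v + leaf' v = leaf'' v)%N) ->
  label_val leaf n c v + label_val leaf' n c v = label_val leaf'' n c v.
Proof.
move=> h; elim: c v => [|c IH] v /=; first by rewrite -natrD h.
by rewrite -big_split /=; apply: eq_bigr => a _; rewrite -mulrDr IH.
Qed.

(** Union bound: each of the [c] draws repeats one of fewer than [Mx] earlier values with
    probability at most [Mx / n]. *)
Lemma label_val_uniq n c v Mx : (0 < n)%N -> uniq v -> (size v + c <= Mx)%N ->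
  1 - (c * Mx)%:R / n%:R <= label_val uniq n c v.
Proof.
move=> n0; elim: c v => [|c IH] v uv sv /=; first by rewrite uv mul0n mul0r subr0.
have n0R : 0 < n%:R :> R by rewrite ltr0n.
pose b : R := 1 - (c * Mx)%:R / n%:R.
(* A repeated value is charged 1, which is enough since [b - 1] is at most 0. *)
apply: (@le_trans _ _ (\sum_(0 <= a < n) n%:R^-1 * (b - (a \in v)%:R))); last first.
  apply: ler_sum => a _; rewrite ler_wpM2l ?invr_ge0 ?ler0n //.
  case: (boolP (a \in v)) => av.
    have /andP[h _] := label_val_bounds uniq n c (rcons v a).
    apply: le_trans h; rewrite /b subr_le0 mulr1n lerBlDr lerDl.
    by rewrite divr_ge0 ?ler0n.
  rewrite subr0; apply: IH; first by rewrite rcons_uniq av.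
  by rewrite size_rcons; lia.
rewrite -mulr_sumr sumrB sumr_const_nat subn0 -[b *+ n]mulr_natl mulrBr mulrA mulVf ?lt0r_neq0 //.
rewrite mul1r -natr_sum.
have cnt : (\sum_(0 <= a < n) (a \in v) <= Mx)%N.
  apply: (@leq_trans (size v)); last by lia.
  rewrite (_ : \sum_(_ <= _ < _) _ = size [seq a <- index_iota 0 n | a \in v])%N.
    apply: uniq_leq_size; first by rewrite filter_uniq // iota_uniq.
    by move=> a; rewrite mem_filter => /andP[].
  rewrite size_filter -sum1_count [RHS]big_mkcond /=.
  by apply: eq_bigr => a _; case: (a \in v).
have : n%:R^-1 * (\sum_(0 <= a < n) (a \in v))%:R <= Mx%:R / n%:R :> R.
  by rewrite mulrC ler_wpM2r ?invr_ge0 ?ler0n // ler_nat.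
by rewrite /b mulSn natrD mulrDl; lra.
Qed.

(** Distinctness is part of success because equal roundings do not determine the order of the
    labels. The leaves for the two values of [b] partition the vectors without repetition. *)
Definition root_leaf (o : ordering) (pe : seq (nat * nat)) (b : bool)
    (v : seq nat) : bool :=
  uniq v && (((0, 1)%N \in
    pair_greedy (pair_le o (fun i j => nth 0%N v i <= nth 0%N v j)%N) pe) == b).

Definition root_val (o : ordering) (n : nat) (b : bool) (m : nat)
    (pe : seq (nat * nat)) : R :=
  label_val (root_leaf o pe b) n (nlabels o m) [::].

Lemma root_valD o n m pe Mx : (0 < n)%N -> (m <= Mx)%N ->
  1 - (Mx * Mx)%:R / n%:R <= root_val o n true m pe + root_val o n false m pe.
Proof.
move=> n0 mM; rewrite /root_val (@label_valD _ _ uniq); last first.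
  by move=> v; rewrite /root_leaf; case: uniq => //=; case: (_ \in _).
have cM : (nlabels o m <= Mx)%N by case: o => /=; lia.
apply: le_trans (label_val_uniq n0 _ (v := [::]) (c := nlabels o m) (Mx := Mx) _) => //.
rewrite lerD2l lerN2 ler_wpM2r ?invr_ge0 ?ler0n // ler_nat leq_mul2r cM orbT //.
Qed.

End Labels.

(** * Measurability of events determined by countable data *)

Section MeasurableSignature.
Context {d : measure_display} {T : measurableType d}.

(** The event is a union of fibres of [sig], of which there are countably many. *)
Lemma measurable_signature (C : countType) (sig : T -> C) (h : T -> Prop) :
  (forall c, measurable [set w | sig w = c]) ->
  (forall w w', sig w = sig w' -> h w -> h w') -> measurable [set w | h w].
Proof.
move=> msig hsig.
pose G c := if `[< exists2 w, sig w = c & h w >] then [set w | sig w = c] else set0.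
rewrite (_ : [set w | h w] = \bigcup_c G c); last first.
  apply/seteqP; split => [w hw|w [c _]] /=.
    by exists (sig w) => //; rewrite /G asboolT //; exists w.
  rewrite /G; case: asboolP => // -[w' <- hw'] /= e.
  exact: (hsig w' w).
apply: countable_bigcupT_measurable; first exact: countableP.
by move=> c; rewrite /G; case: ifP => // _; exact: measurable0.
Qed.

Lemma measurable_bools (I : eqType) (l : seq I) (b : I -> T -> bool) (h : T -> Prop) :
  (forall i, i \in l -> measurable [set w | b i w]) ->
  (forall w w', (forall i, i \in l -> b i w = b i w') -> h w -> h w') ->
  measurable [set w | h w].
Proof.
move=> mb hb; apply: (@measurable_signature _ (fun w => [seq b i w | i <- l])).
  elim: l mb {hb} => [|i l IH] mb c /=.
    by case: c => [|x c]; [rewrite (_ : [set _ | _] = setT)|rewrite (_ : [set _ | _] = set0)];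
      rewrite ?predeqE // => w; split.
  case: c => [|x c]; first by rewrite (_ : [set _ | _] = set0) // predeqE => w; split.
  rewrite (_ : [set _ | _] = [set w | b i w = x] `&` [set w | [seq b j w | j <- l] = c]).
    apply: measurableI; last by apply: IH => j jl; apply: mb; rewrite inE jl orbT.
    have mi : measurable [set w | b i w] by apply: mb; rewrite mem_head.
    case: x => //; rewrite (_ : [set _ | _] = ~` [set w | b i w]); first exact: measurableC.
    by apply/seteqP; split => w /=; case: (b i w).
  by apply/seteqP; split => w /= [-> ->].
move=> w w' e; apply: hb => i il.
have := congr1 (fun s => nth false s (index i l)) e.
by rewrite !(nth_map i) ?index_mem // nth_index.
Qed.

End MeasurableSignature.

(** * The two random orderings as comparisons of uniform labels *)

Definition label (o : ordering) (V : choiceType) : choiceType :=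
  match o with edge_arrival => {fset V} | vertex_seeds => V end.

Definition label_of (o : ordering) (V : choiceType) (phi : nat -> V)
    (pe : seq (nat * nat)) (i : nat) : label o V :=
  match o return label o V with
  | edge_arrival => edge_of phi (nth (0, 0)%N pe i)
  | vertex_seeds => phi i
  end.

(* The [i]-th pair of [pe] joins vertex [i.+1] to an earlier vertex. *)
Definition tree_pairs (m : nat) (pe : seq (nat * nat)) : Prop :=
  all (pair_ok m) pe /\ map snd pe = iota 1 m.-1.

Lemma tree_pairs_nth m pe (p : nat * nat) : tree_pairs m pe -> p \in pe ->
  nth (0, 0)%N pe p.2.-1 = p.
Proof.
move=> [_ e] /(nthP (0, 0)%N)[i im <-].
have sz : size pe = m.-1 by rewrite -(size_map snd) e size_iota.
by rewrite -[in LHS](nth_map (0, 0)%N 0%N snd) // e nth_iota ?add1n // -sz.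
Qed.

Lemma label_of_inj o (V : choiceType) (phi : nat -> V) m pe i j :
  (forall i j, (i < m)%N -> (j < m)%N -> phi i = phi j -> i = j) ->
  tree_pairs m pe -> (i < nlabels o m)%N -> (j < nlabels o m)%N ->
  label_of o phi pe i = label_of o phi pe j -> i = j.
Proof.
move=> inj [ok e]; have sz : size pe = m.-1 by rewrite -(size_map snd) e size_iota.
case: o => /= im jm; last exact: inj.
have ni k : (k < m.-1)%N -> nth (0, 0)%N pe k \in pe by move=> km; rewrite mem_nth // sz.
move/(edge_of_inj inj) => /(_ (allP ok _ (ni _ im)) (allP ok _ (ni _ jm))) /(congr1 snd).
rewrite -!(nth_map (0, 0)%N 0%N snd) ?sz // e !nth_iota //; lia.
Qed.

Section RandomOrder.
Context {R : realType}.

(** The maxima lie in [0,1], so the [eta] terms differ by at most [eta], which is less than the gap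
    between distinct minima and cannot reverse their order. When the minima agree, the maxima
    decide. *)
Lemma lex_time (s t s' t' eta : R) :
  0 <= s <= 1 -> 0 <= t <= 1 -> 0 <= s' <= 1 -> 0 <= t' <= 1 -> 0 < eta ->
  (forall a b, a \in [:: s; t] -> b \in [:: s'; t'] -> a != b -> eta < `|a - b|) ->
  (Num.min s t + eta * Num.max s t <= Num.min s' t' + eta * Num.max s' t') =
  let lo s t := if s <= t then s else t in
  let hi s t := if s <= t then t else s in
  (lo s t <= lo s' t') && (~~ (lo s' t' <= lo s t) || (hi s t <= hi s' t')).
Proof.
move=> s01 t01 s01' t01' eta0 sep /=.
have minE (x y : R) : Num.min x y = if x <= y then x else y by rewrite minElt; case: ltgtP.
have maxE (x y : R) : Num.max x y = if x <= y then y else x by rewrite maxElt; case: ltgtP.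
rewrite !minE !maxE.
set a := if s <= t then s else t; set b := if s <= t then t else s.
set a' := if s' <= t' then s' else t'; set b' := if s' <= t' then t' else s'.
have b01 : 0 <= b <= 1 by rewrite /b; case: ifP.
have b01' : 0 <= b' <= 1 by rewrite /b'; case: ifP.
have aa' : a != a' -> eta < `|a - a'|.
  apply: sep; first by rewrite /a; case: ifP; rewrite !inE eqxx ?orbT.
  by rewrite /a'; case: ifP; rewrite !inE eqxx ?orbT.
case: (ltgtP a a') aa' => [lt|gt|->] aa' /=.
- have := aa' isT; rewrite ltr0_norm; last by lra.
  by move=> h; apply/idP; nra.
- have := aa' isT; rewrite gtr0_norm; last by lra.
  by move=> h; apply/negbTE; rewrite -ltNge; nra.
by rewrite lerD2l ler_pM2l.
Qed.

Lemma uniform_itv (x y : R) : 0 <= x -> x <= y -> y <= 1 ->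
  uniform_prob (@ltr01 R) `[x, y[%classic = (y - x)%:E.
Proof.
move=> x0 xy y1; rewrite /uniform_prob.
rewrite (eq_integral (cst 1%E)); last first.
  move=> z; rewrite inE /= in_itv /= => /andP[xz zy].
  by rewrite /uniform_pdf ifT ?subr0 ?invr1 //; apply/andP; split; lra.
rewrite integral_cst //= mul1e lebesgue_measure_itv /= lte_fin.
case: ifP => [_|/negbT]; first by rewrite EFinB.
by rewrite -leNgt => yx; rewrite (_ : y = x) ?subrr //; apply/eqP; rewrite eq_le xy yx.
Qed.

Context {d : measure_display} {T : measurableType d} (P : probability T R).

(** Both orderings become independent uniform labels together with the comparison rule [pair_le].
    The last clause is for measurability: [eta] is an arbitrary function of the outcome, so
    comparisons of [tau] are replaced by events defined through the labels. *)
Lemma random_orderP o (V I : choiceType) (D : set I) (F : I -> set_system T)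
    (pE : set {fset V}) (W : T -> set V) (tau : T -> {fset V} -> R) :
  (forall f, pE f -> exists a b, f = [fset a; b]%fset) ->
  random_order o P D F pE W tau ->
  exists (Z : label o V -> {RV P >-> R}) (DZ : set (label o V)),
  [/\ forall z, DZ z -> uniform01 (Z z),
      joint_independence P D F DZ (fun z => g_sigma_algebra_preimage (Z z)),
      forall phi m pe i, tree_pairs m pe ->
        (forall p, p \in pe -> pE (edge_of phi p)) ->
        (i < nlabels o m)%N -> DZ (label_of o phi pe i),
      forall w phi m pe, tree_pairs m pe ->
        (forall p, p \in pe -> pE (edge_of phi p)) ->
        finite_set (W w) -> (forall i, (i < m)%N -> W w (phi i)) ->
        forall p p', p \in pe -> p' \in pe ->
        (tau w (edge_of phi p) <= tau w (edge_of phi p')) =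
        pair_le o (fun i j => Z (label_of o phi pe i) w <= Z (label_of o phi pe j) w)
          p p' &
      exists A : {fset V} * {fset V} -> set T, (forall fg, measurable (A fg)) /\
        (forall w, finite_set (W w) -> forall f g, pE f -> pE g ->
           (forall v, v \in f -> W w v) -> (forall v, v \in g -> W w v) ->
           (tau w f <= tau w g) = `[< A (f, g) w >])].
Proof.
move=> pE2; have mle (X Y : {RV P >-> R}) : measurable [set w | X w <= Y w].
  by rewrite -[X in measurable X]setTI; apply: measurable_fun_le.
case: o => /=.
  move=> [U [Uu Uind tauU]]; exists U, pE; split => //.
  - move=> phi m pe i [_ e] pepE im; apply: pepE; rewrite mem_nth //.
    by rewrite -(size_map snd) e size_iota.
  - move=> w phi m pe tp pepE _ _ p p' ppe ppe'.
    by rewrite /label_of !(tree_pairs_nth tp) // !tauU //; apply: pepE.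
  - exists (fun fg => [set w | U fg.1 w <= U fg.2 w]); split; first by move=> fg; exact: mle.
    by move=> w _ f g fE gE _ _; rewrite !tauU //= asboolb.
move=> [S [eta [Su Sind etaP tauS]]]; exists S, setT.
have S01 v w : 0 <= S v w <= 1 by case: (Su v).
split => //.
  move=> w phi m pe [/allP ok _] pepE fW Wphi p p' ppe ppe'.
  have [eta0 sep] := etaP w fW.
  have := ok _ ppe; have := ok _ ppe'; rewrite /pair_ok => okp okp'.
  rewrite {1}/edge_of {1}/edge_of !tauS //; try exact: pepE.
  rewrite lex_time //; try exact: S01.
    rewrite /label_of /=; case: ifP => _; case: ifP => _ //.
  by move=> a b; rewrite !inE => /orP[] /eqP -> /orP[] /eqP ->; apply: sep;
    apply: Wphi; lia.
suff /choice[A AP] : forall fg, exists A : set T, measurable A /\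
    (forall w, finite_set (W w) -> pE fg.1 -> pE fg.2 ->
      (forall v, v \in fg.1 -> W w v) -> (forall v, v \in fg.2 -> W w v) ->
      (tau w fg.1 <= tau w fg.2) = `[< A w >]).
  exists A; split => [fg|w fW f g fE gE fW' gW']; first by case: (AP fg).
  by have [_ /(_ w)] := AP (f, g); apply.
(* Nothing is asked of a pair with an impossible edge, so the empty set serves there. *)
move=> [f g] /=; have [fE|nfE] := pselect (pE f); last by exists set0; split.
have [gE|ngE] := pselect (pE g); last by exists set0; split.
have [a [b ef]] := pE2 f fE; have [c [e eg]] := pE2 g gE.
pose lo (s t : R) := if s <= t then s else t.
pose hi (s t : R) := if s <= t then t else s.
pose le w := (lo (S a w) (S b w) <= lo (S c w) (S e w)) &&
  (~~ (lo (S c w) (S e w) <= lo (S a w) (S b w)) ||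
   (hi (S a w) (S b w) <= hi (S c w) (S e w))).
exists [set w | le w]; split.
  pose l := [:: a; b; c; e].
  apply: (@measurable_bools _ _ _ [seq (x, y) | x <- l, y <- l]
    (fun xy w => S xy.1 w <= S xy.2 w)) => [xy _|w w' ww']; first exact: mle.
  have h x y : x \in l -> y \in l -> (S x w <= S y w) = (S x w' <= S y w').
    by move=> xl yl; apply: (ww' (x, y)); apply: allpairs_f.
  have [l1 l2 l3 l4] : [/\ a \in l, b \in l, c \in l & e \in l].
    by rewrite !inE !eqxx ?orbT.
  rewrite /le /lo /hi (h _ _ l1 l2) (h _ _ l3 l4).
  by case: ifP => _; case: ifP => _; rewrite !h.
move=> w fW _ _ fW' gW'; have [eta0 sep] := etaP w fW; rewrite asboolb.
rewrite {1}ef {1}eg !tauS -?ef -?eg // lex_time //; try exact: S01.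
have f1 : W w a by apply: fW'; rewrite ef !inE eqxx.
have f2 : W w b by apply: fW'; rewrite ef !inE eqxx orbT.
have g1 : W w c by apply: gW'; rewrite eg !inE eqxx.
have g2 : W w e by apply: gW'; rewrite eg !inE eqxx orbT.
by move=> x y; rewrite !inE => /orP[] /eqP -> /orP[] /eqP ->; apply: sep.
Qed.

End RandomOrder.

(** * One-sided Poisson approximation *)

Section LeCam.
Context {R : realType}.

Definition pois (la : R) (k : nat) : R := expR (- la) * (la ^+ k / k`!%:R).

Lemma pois1 k : pois 1 k = poisson_pmf 1 k.
Proof. by rewrite poisson1E /pois expr1n mul1r. Qed.

Lemma expr_fact_bounds (la : R) k : 0 <= la <= 1 -> 0 <= la ^+ k / k`!%:R <= 1.
Proof.
move=> /andP[la0 la1]; rewrite divr_ge0 ?exprn_ge0 ?ler0n //=.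
rewrite ler_pdivrMr ?ltr0n ?fact_gt0 // mul1r.
by apply: le_trans (exprn_ile1 _ _ _) _ => //; rewrite ler1n fact_gt0.
Qed.

Lemma pois_bounds (la : R) k : 0 <= la <= 1 -> 0 <= pois la k <= 1.
Proof.
move=> la01; have /andP[h0 h1] := expr_fact_bounds k la01.
have e1 : expR (- la) <= 1 by rewrite -[leRHS]expR0 ler_expR; lra.
have e0 : 0 <= expR (- la) by exact: expR_ge0.
by rewrite /pois mulr_ge0 //= mulr_ile1.
Qed.

(** The binomial expansion with its terms of order 0 and 1 in [x] kept. The induction multiplies by
    [(la + x) / k.+1]; the new second-order terms amount to at most twice [x ^+ 2], which the
    denominator absorbs. *)
Lemma expr_fact_step (la x : R) k : 0 <= la -> 0 <= x -> la + x <= 1 ->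
  (la + x) ^+ k / k`!%:R <= la ^+ k / k`!%:R +
    (if k is k'.+1 then x * (la ^+ k' / k'`!%:R) else 0) + x ^+ 2.
Proof.
move=> la0 x0 lax; elim: k => [|k IH].
  by rewrite !expr0 addr0 lerDl sqr_ge0.
have k0 : 0 < k.+1%:R :> R by rewrite ltr0n.
have la01 : 0 <= la <= 1 by lra.
have qS (y : R) j : y ^+ j.+1 / j.+1`!%:R = y / j.+1%:R * (y ^+ j / j`!%:R).
  by rewrite exprS factS natrM invfM mulrACA.
rewrite !qS.
apply: (@le_trans _ _ ((la + x) / k.+1%:R * (la ^+ k / k`!%:R +
    (if k is k'.+1 then x * (la ^+ k' / k'`!%:R) else 0) + x ^+ 2))).
  by rewrite ler_wpM2l // divr_ge0 ?ler0n //; lra.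
case: k {IH} k0 => [|k] k0.
  by rewrite !expr0 fact0 !divr1; nra.
have /andP[q0 q1] := expr_fact_bounds k la01.
rewrite qS; set q := la ^+ k / k`!%:R in q0 q1 *.
have k1 : 1 <= k.+1%:R :> R by rewrite ler1n.
have -> : k.+2%:R = k.+1%:R + 1 :> R by rewrite natr1.
set c : R := k.+1%:R in k1 *.
clearbody c.
have c0 : 0 < c + 1 by lra.
have cn : c != 0 by rewrite lt0r_neq0 //; lra.
have cn1 : c + 1 != 0 by rewrite lt0r_neq0.
rewrite -(ler_pM2r c0).
have -> : (la + x) / (c + 1) * (la / c * q + x * q + x ^+ 2) * (c + 1) =
          (la + x) * (la / c * q + x * q + x ^+ 2).
  by field; rewrite ?cn ?cn1.
have -> : (la / (c + 1) * (la / c * q) + x * (la / c * q) + x ^+ 2) * (c + 1) =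
    la * (la / c * q) + x * la * q + x * (la / c * q) + x ^+ 2 * (c + 1).
  by field; rewrite ?cn ?cn1.
have : x ^+ 2 * q <= x ^+ 2 by rewrite ler_piMr // sqr_ge0.
have : (la + x) * x ^+ 2 <= x ^+ 2 * 1 by rewrite mulrC ler_wpM2l // sqr_ge0.
have : x ^+ 2 * 2 <= x ^+ 2 * (c + 1) by rewrite ler_wpM2l ?sqr_ge0 //; lra.
rewrite (_ : (la + x) * (la / c * q + x * q + x ^+ 2) =
  la * (la / c * q) + x * la * q + x * (la / c * q) + x ^+ 2 * q + (la + x) * x ^+ 2);
  last by field; rewrite ?cn ?cn1.
lra.
Qed.

(** Since expR x >= 1 + x, it suffices that (1 - x + x^2)(1 + x) = 1 + x^3 is at least 1. *)
Lemma expRN_le (x : R) : 0 <= x -> expR (- x) <= 1 - x + x ^+ 2.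
Proof.
move=> x0; have h := expR_ge1Dx x.
have e : expR (- x) * expR x = 1 by rewrite -expRD addNr expR0.
have e0 := expR_gt0 (- x).
have h1 : expR (- x) * (1 + x) <= 1 by rewrite -[leRHS]e ler_pM2l.
have h2 : 1 <= (1 - x + x ^+ 2) * (1 + x).
  have : 0 <= x ^+ 3 by rewrite exprn_ge0.
  by move=> x3; rewrite (_ : (1 - x + x ^+ 2) * (1 + x) = 1 + x ^+ 3); [lra|ring].
have x1 : 0 < 1 + x by lra.
rewrite -(ler_pM2r x1); exact: le_trans h1 h2.
Qed.

(** A Poisson([la + x]) variable is a Poisson([la]) one plus an independent Poisson([x]) one, and
    the latter is a Bernoulli([x]) variable up to order [x ^+ 2]. Only this direction is used, as
    explorations are bounded from below. *)
Lemma pois_step (la x : R) k : 0 <= la -> 0 <= x -> la + x <= 1 ->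
  pois (la + x) k <= (1 - x) * pois la k +
    (if k is k'.+1 then x * pois la k' else 0) + 4 * x ^+ 2.
Proof.
move=> la0 x0 lax; have la01 : 0 <= la <= 1 by lra.
have st := expr_fact_step k la0 x0 lax.
have /andP[q0 q1] := expr_fact_bounds k la01.
set q := la ^+ k / k`!%:R in st q0 q1.
set q' := (if k is k'.+1 then la ^+ k' / k'`!%:R else 0).
have q'01 : 0 <= q' <= 1.
  by rewrite /q'; case: (k) => [|k']; [rewrite lexx ler01|exact: expr_fact_bounds].
have e1 : (if k is k'.+1 then x * (la ^+ k' / k'`!%:R) else 0) = x * q'.
  by rewrite /q'; case: (k) => //; rewrite mulr0.
have e2 : (if k is k'.+1 then x * pois la k' else 0) = expR (- la) * (x * q').
  by rewrite /q' /pois; case: (k) => [|k']; rewrite ?mulr0 // mulrCA.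
have e3 : pois (la + x) k = expR (- la) * (expR (- x) * ((la + x) ^+ k / k`!%:R)).
  by rewrite /pois opprD expRD -mulrA.
rewrite e1 in st; rewrite e2 e3 (_ : pois la k = expR (- la) * q) //.
have ex := expRN_le x0.
have el0 : 0 <= expR (- la) by exact: expR_ge0.
have el1 : expR (- la) <= 1 by rewrite -[leRHS]expR0 ler_expR; lra.
have x21 : x ^+ 2 <= x by rewrite expr2 ler_piMr //; lra.
have x20 : 0 <= x ^+ 2 by exact: sqr_ge0.
set X := x ^+ 2 in st ex x21 x20 *.
have xq : 0 <= x * q' <= 1.
  by case/andP: q'01 => a b; rewrite mulr_ge0 //= mulr_ile1 //; lra.
have main : expR (- x) * ((la + x) ^+ k / k`!%:R) <= (1 - x) * q + x * q' + 4 * X.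
  apply: (@le_trans _ _ ((1 - x + X) * (q + x * q' + X))).
    apply: ler_pM => //.
    by rewrite divr_ge0 ?exprn_ge0 ?ler0n //; lra.
  (* Three copies of [X] come from here, as each summand is at most 1, and the fourth from the
     product with [1 - x] in [a2]. *)
  have a1 : X * (q + x * q' + X) <= X * 3 by rewrite ler_wpM2l //; lra.
  have a2 : (1 - x) * (x * q' + X) <= 1 * (x * q' + X) by rewrite ler_wpM2r //; lra.
  by rewrite (_ : (1 - x + X) * (q + x * q' + X) =
    (1 - x) * q + (1 - x) * (x * q' + X) + X * (q + x * q' + X)); [lra|ring].
apply: (@le_trans _ _ (expR (- la) * ((1 - x) * q + x * q' + 4 * X))).
  by rewrite ler_wpM2l.
have : expR (- la) * (4 * X) <= 4 * X by rewrite ler_piMl //; lra.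
rewrite (_ : expR (- la) * ((1 - x) * q + x * q' + 4 * X) =
  (1 - x) * (expR (- la) * q) + expR (- la) * (x * q') + expR (- la) * (4 * X));
  [lra|ring].
Qed.

(** Bernoulli's inequality for [la ^+ k], together with expR (- la) >= expR (-1). *)
Lemma pois_ge (la : R) k : 0 <= la <= 1 -> pois 1 k - k%:R * (1 - la) <= pois la k.
Proof.
move=> la01; have bern : 1 - k%:R * (1 - la) <= la ^+ k.
  elim: k => [|k IH]; first by rewrite mul0r subr0.
  rewrite exprS; apply: (@le_trans _ _ (la * (1 - k%:R * (1 - la)))).
    have k0 : 0 <= k%:R :> R by rewrite ler0n.
    have -> : k.+1%:R = k%:R + 1 :> R by rewrite natr1.
    have : 0 <= k%:R * (1 - la) ^+ 2 by rewrite mulr_ge0 // sqr_ge0.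
    move=> h; rewrite (_ : la * _ =
      1 - (k%:R + 1) * (1 - la) + k%:R * (1 - la) ^+ 2); [lra|ring].
  by rewrite ler_wpM2l //; lra.
have kl : 0 <= k%:R * (1 - la) by rewrite mulr_ge0 ?ler0n //; lra.
have f1 : 1 <= k`!%:R :> R by rewrite ler1n fact_gt0.
have f0 : 0 < k`!%:R :> R by rewrite ltr0n fact_gt0.
have fi : k`!%:R^-1 <= 1 :> R by rewrite invf_le1.
have fi0 : 0 <= k`!%:R^-1 :> R by rewrite invr_ge0 ltW.
have e01 : expR (-1) <= 1 :> R by rewrite -[leRHS]expR0 ler_expR; lra.
have e00 : 0 <= expR (-1) :> R by exact: expR_ge0.
apply: (@le_trans _ _ (expR (-1) * (la ^+ k / k`!%:R))); last first.
  rewrite /pois ler_wpM2r ?ler_expR; [by []| |by lra].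
  by rewrite divr_ge0 ?exprn_ge0 ?ler0n //; lra.
apply: (@le_trans _ _ (expR (-1) * ((1 - k%:R * (1 - la)) / k`!%:R))); last first.
  by rewrite ler_wpM2l // ler_wpM2r.
have -> : expR (-1) * ((1 - k%:R * (1 - la)) / k`!%:R) =
    pois 1 k - (k%:R * (1 - la)) * (expR (-1) / k`!%:R).
  by rewrite /pois expr1n; ring.
by rewrite lerD2l lerN2 ler_piMr // mulr_ile1.
Qed.

(** [j] counts the neighbours already found, and [B] is the value of the continuation as a function
    of their final number. *)
Definition pois_mean (K : nat) (B : nat -> R) (la : R) (j : nat) : R :=
  \sum_(0 <= k < K.+1) pois la k * B (j + k)%N.

Lemma pois_mean_step K B (la x : R) j : (forall k, 0 <= B k <= 1) ->
  0 <= la -> 0 <= x -> la + x <= 1 ->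
  pois_mean K B (la + x) j <=
  x * pois_mean K B la j.+1 + (1 - x) * pois_mean K B la j + 4 * K.+1%:R * x ^+ 2.
Proof.
move=> B01 la0 x0 lax; have la01 : 0 <= la <= 1 by lra.
have B0 k : 0 <= B k by case/andP: (B01 k).
have B1 k : B k <= 1 by case/andP: (B01 k).
apply: (@le_trans _ _ (\sum_(0 <= k < K.+1) ((1 - x) * pois la k +
    (if k is k'.+1 then x * pois la k' else 0) + 4 * x ^+ 2) * B (j + k)%N)).
  apply: ler_sum => k _; rewrite ler_wpM2r //; exact: pois_step.
have -> : \sum_(0 <= k < K.+1) ((1 - x) * pois la k +
    (if k is k'.+1 then x * pois la k' else 0) + 4 * x ^+ 2) * B (j + k)%N =
  (1 - x) * pois_mean K B la j +
  \sum_(0 <= k < K.+1) (if k is k'.+1 then x * pois la k' else 0) * B (j + k)%N +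
  \sum_(0 <= k < K.+1) 4 * x ^+ 2 * B (j + k)%N.
  rewrite /pois_mean mulr_sumr -!big_split /=; apply: eq_bigr => k _.
  by rewrite !mulrDl !mulrA.
have t1 : \sum_(0 <= k < K.+1) (if k is k'.+1 then x * pois la k' else 0) * B (j + k)%N
    <= x * pois_mean K B la j.+1.
  (* The Bernoulli success shifts the index by one; the top term of the shifted sum falls outside
     the truncation and is dropped, being nonnegative. *)
  rewrite big_nat_recl //= mul0r add0r /pois_mean big_nat_recr //= mulrDr mulr_sumr.
  apply: (@le_trans _ _ (\sum_(0 <= k < K) x * (pois la k * B (j.+1 + k)%N))).
    by apply: ler_sum => k _; rewrite addnS addSn mulrA.
  have /andP[p0 _] := pois_bounds K la01.
  by rewrite lerDl mulr_ge0 // mulr_ge0.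
have t2 : \sum_(0 <= k < K.+1) 4 * x ^+ 2 * B (j + k)%N <= 4 * K.+1%:R * x ^+ 2.
  apply: (@le_trans _ _ (\sum_(0 <= k < K.+1) 4 * x ^+ 2)).
    apply: ler_sum => k _; rewrite ler_piMr // mulr_ge0 ?sqr_ge0 //.
  by rewrite sumr_const_nat subn0 -[X in X <= _]mulr_natl mulrCA mulrA.
lra.
Qed.

Lemma pois_mean_bounds K B (la : R) j : (forall k, 0 <= B k <= 1) -> 0 <= la <= 1 ->
  0 <= pois_mean K B la j <= K.+1%:R.
Proof.
move=> B01 la01; apply/andP; split.
  apply: sumr_ge0 => k _; rewrite mulr_ge0 //; first by case/andP: (pois_bounds k la01).
  by case/andP: (B01 (j + k)%N).
apply: (@le_trans _ _ (\sum_(0 <= k < K.+1) 1)); last by rewrite sumr_const_nat subn0.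
apply: ler_sum => k _; case/andP: (pois_bounds k la01) => p0 p1.
by case/andP: (B01 (j + k)%N) => b0 b1; exact: mulr_ile1.
Qed.

Lemma pois_mean0 K B j : pois_mean K B 0 j = B j.
Proof.
rewrite /pois_mean big_nat_recl // big1 ?addr0.
  by rewrite /pois oppr0 expR0 expr0 fact0 divr1 !mul1r addn0.
by move=> k _; rewrite /pois expr0n /= mul0r mulr0 mul0r.
Qed.

Lemma pois_mean_ge K B (la : R) j : (forall k, 0 <= B k <= 1) -> 0 <= la <= 1 ->
  pois_mean K B 1 j - K.+1%:R * K%:R * (1 - la) <= pois_mean K B la j.
Proof.
move=> B01 la01.
apply: (@le_trans _ _ (\sum_(0 <= k < K.+1)
    (pois 1 k - K%:R * (1 - la)) * B (j + k)%N)).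
  under [leRHS]eq_bigr do rewrite mulrBl.
  rewrite sumrB lerD2l lerN2.
  apply: (@le_trans _ _ (\sum_(0 <= k < K.+1) K%:R * (1 - la))).
    apply: ler_sum => k _; case/andP: (B01 (j + k)%N) => b0 b1.
    by rewrite ler_piMr // mulr_ge0 ?ler0n //; lra.
  by rewrite sumr_const_nat subn0 -[X in X <= _]mulr_natl mulrA.
apply: ler_sum_nat => k /= kK; case/andP: (B01 (j + k)%N) => b0 b1.
rewrite ler_wpM2r //; apply: le_trans (pois_ge k la01).
rewrite lerD2l lerN2 ler_wpM2r //; first by lra.
by rewrite ler_nat.
Qed.

End LeCam.

(** * Discrete observations and the leaf test *)

Section Observations.
Context {R : realType} {d : measure_display} {T : measurableType d}.
Context (P : probability T R) {I L : choiceType}.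
Context {d' : measure_display} {C : measurableType d'}.
Variables (X : I -> {RV P >-> C}) (enc : C -> nat) (Z : L -> {RV P >-> R}) (n : nat).

(** Labels are seen through half-open cells of length [1 / n], which makes the answers exclusive. A
    label equal to 1 falls in cell [n], an answer that [label_tree] does not list. *)
Definition obs_event (k : I + L) (a : nat) : set T :=
  match k with
  | inl i => [set w | enc (X i w) = a]
  | inr z => [set w | a%:R / n%:R <= Z z w < a.+1%:R / n%:R]
  end.

Lemma label_event_lt z z' a a' w : obs_event (inr z) a w ->
  obs_event (inr z') a' w -> (a < a')%N -> Z z w < Z z' w.
Proof.
move=> /= /andP[_ h] /andP[h' _] aa'; apply: (lt_le_trans h); apply: le_trans h'.
by rewrite ler_wpM2r ?invr_ge0 ?ler0n // ler_nat.
Qed.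

Lemma obs_event_disjoint k a b w : obs_event k a w -> obs_event k b w -> a = b.
Proof.
case: k => [i /= <- //|z ha hb].
case: (ltngtP a b) => // ab.
  by have := label_event_lt ha hb ab; rewrite ltxx.
by have := label_event_lt hb ha ab; rewrite ltxx.
Qed.

Lemma prob_label_event z a : uniform01 (Z z) -> (a < n)%N ->
  fine (P (obs_event (inr z) a)) = n%:R^-1.
Proof.
move=> [_ uZ] an; have n0 : 0 < n%:R :> R by rewrite ltr0n; lia.
have := uZ `[a%:R / n%:R, a.+1%:R / n%:R[%classic (measurable_itv _).
rewrite uniform_itv; last 3 first.
- by rewrite divr_ge0 ?ler0n.
- by rewrite ler_wpM2r ?invr_ge0 ?ler0n // ler_nat.
- by rewrite ler_pdivrMr // mul1r ler_nat.
rewrite /distribution /pushforward => h.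
have -> : obs_event (inr z) a = Z z @^-1` `[a%:R / n%:R, a.+1%:R / n%:R[%classic.
  by apply/seteqP; split => w /=; rewrite in_itv.
by rewrite h /= -mulrBl -natr1 addrAC subrr add0r mul1r.
Qed.

Variables (D : set I) (DZ : set L).
Hypothesis enc_measurable : forall a, measurable [set c | enc c = a].
Hypothesis indep : joint_independence P D (fun i => g_sigma_algebra_preimage (X i))
  DZ (fun z => g_sigma_algebra_preimage (Z z)).

Definition obs_dom : set (I + L) :=
  [set k | match k with inl i => D i | inr z => DZ z end].

(** The observations [v] on [J] are imposed beforehand: none of them for the Galton-Watson tree, and
    the activity of the given edge for the graph, which is how the conditioning enters. *)
Lemma obs_lower_bound (M : set T) t (S : set (I + L)) (J : {fset I + L})
    (v : I + L -> nat) : measurable M ->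
  S `<=` obs_dom -> [set` J] `<=` obs_dom -> (forall k, k \in J -> ~ S k) ->
  dfresh S t ->
  (forall w, (forall k, k \in J -> obs_event k (v k) w) ->
     drun obs_event t w -> M w) ->
  (\prod_(k <- J) fine (P (obs_event k (v k)))) *
    dval (fun k a => fine (P (obs_event k a))) t <=
  fine (P (M `&` \bigcap_(k in [set` J]) obs_event k (v k))).
Proof.
move=> mM SD JD JS fr h.
pose F (k : I + L) : set_system T := match k with
  | inl i => g_sigma_algebra_preimage (X i)
  | inr z => g_sigma_algebra_preimage (Z z) end.
have evF k a : F k (obs_event k a).
  case: k => [i|z] /=.
    by exists [set c | enc c = a] => //; rewrite setTI.
  exists `[a%:R / n%:R, a.+1%:R / n%:R[%classic; first exact: measurable_itv.
  by rewrite setTI; apply/seteqP; split => w /=; rewrite in_itv.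
apply: (@dtree_lower_bound R (I + L)%type d T P obs_dom F obs_event) fr h => //.
- move=> [i|z] A _ /= [B mB <-]; rewrite setTI; exact: measurable_funPTI.
- by move=> k a b w _; exact: obs_event_disjoint.
Qed.

End Observations.

Section RootLeaf.
Context {R : realType} {d : measure_display} {T : measurableType d}.
Context (P : probability T R) {I V : choiceType} (o : ordering).
Context {d' : measure_display} {C : measurableType d'}.
Variables (X : I -> {RV P >-> C}) (enc : C -> nat) (Z : label o V -> {RV P >-> R}).

Definition root_tree (n : nat) (b : bool) (phi : nat -> V) (m : nat)
    (pe : seq (nat * nat)) : dtree (I + label o V) :=
  label_tree (fun i => inr (label_of o phi pe i)) (root_leaf o pe b) n
    (nlabels o m) [::].

(** At a successful leaf the roundings are distinct, so they are ordered like the labels themselves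
    and fix the processing order of the whole component; [greedy_component] then reads off the
    outcome. *)
Lemma drun_root_tree n b phi m pe (tau : {fset V} -> R) (act : pred {fset V})
    (E : {fset {fset V}}) w :
  (forall i j, (i < m)%N -> (j < m)%N -> phi i = phi j -> i = j) ->
  tree_pairs m pe -> (0, 1)%N \in pe ->
  (forall p, p \in pe -> edge_of phi p \in E /\ act (edge_of phi p)) ->
  (forall f p v, f \in E -> act f -> p \in pe -> v \in f ->
     v \in edge_of phi p -> f \in map (edge_of phi) pe) ->
  (forall p p', p \in pe -> p' \in pe ->
     (tau (edge_of phi p) <= tau (edge_of phi p')) =
     pair_le o (fun i j => Z (label_of o phi pe i) w <= Z (label_of o phi pe j) w)
       p p') ->
  drun (obs_event X enc Z n) (root_tree n b phi m pe) w ->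
  (edge_of phi (0, 1)%N \in greedy_crs tau act E) = b.
Proof.
move=> inj tp root peE closed tauE rw.
have [//|v [sv /andP[uv /eqP lb] evv]] := drun_label_tree rw.
rewrite /= add0n in sv.
have [ok e] := tp.
rewrite (@greedy_component _ _ _ _ _ o (fun i j => nth 0%N v i <= nth 0%N v j)%N phi m pe) //.
- by rewrite e iota_uniq.
- move=> i j im jm ij ji.
  by apply/eqP; rewrite -(nth_uniq 0%N _ _ uv) ?sv // eqn_leq ij ji.
move=> p p' ppe ppe'; rewrite tauE //.
apply: (@eq_pair_le _ m); [|exact: (allP ok)|exact: (allP ok)].
move=> i j im jm; have evi := evv i; have evj := evv j.
rewrite sv in evi evj; have {}evi := evi im; have {}evj := evj jm.
case: (ltngtP (nth 0%N v i) (nth 0%N v j)) => vij.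
- by rewrite ltW // (label_event_lt evi evj vij).
- by apply/negbTE; rewrite -ltNge (label_event_lt evj evi vij).
have -> : i = j by apply/eqP; rewrite -(nth_uniq 0%N _ _ uv) ?sv // vij.
by rewrite lexx.
Qed.

Lemma dval_root_tree n b phi m pe :
  (forall i, (i < nlabels o m)%N -> uniform01 (Z (label_of o phi pe i))) ->
  dval (fun k a => fine (P (obs_event X enc Z n k a))) (root_tree n b phi m pe) =
  root_val o n b m pe.
Proof.
move=> u; apply: dval_label_tree => i a /=; rewrite add0n => im an.
exact: (prob_label_event X enc (u i im) an).
Qed.

Lemma dfresh_root_tree (S : set (I + label o V)) n b phi m pe :
  (forall i j, (i < m)%N -> (j < m)%N -> phi i = phi j -> i = j) ->
  tree_pairs m pe ->
  (forall i, (i < nlabels o m)%N -> S (inr (label_of o phi pe i))) ->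
  dfresh S (root_tree n b phi m pe).
Proof.
move=> inj tp h; apply: dfresh_label_tree => /= [i|i j]; rewrite add0n => im.
  by apply: h; lia.
by move=> jm [] /(label_of_inj inj tp); apply; lia.
Qed.

End RootLeaf.

(** * Exploration of the Galton-Watson tree *)

Definition stack_ok (m : nat) (st : seq nat) : bool :=
  uniq st && all (fun p => (p < m)%N) st.

Lemma stack_ok_step m k p st : stack_ok m (p :: st) ->
  stack_ok (m + k) (iota m k ++ st).
Proof.
rewrite /stack_ok /= => /andP[/andP[_ us] /andP[_ /allP stm]].
rewrite cat_uniq iota_uniq us /= andbT; apply/andP; split.
  by apply/hasPn => q /stm; rewrite /= mem_iota; lia.
rewrite all_cat; apply/andP; split; apply/allP => q; first by rewrite mem_iota; lia.
by move/stm; lia.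
Qed.

Lemma tree_pairs_step m k p pe : (p < m)%N -> tree_pairs m pe ->
  tree_pairs (m + k) (pe ++ [seq (p, j) | j <- iota m k]).
Proof.
move=> pm [/allP ok e]; split.
  apply/allP => q; rewrite mem_cat => /orP[/ok|/mapP[j]]; first by rewrite /pair_ok; lia.
  by rewrite mem_iota /pair_ok => jm -> /=; lia.
rewrite map_cat e -map_comp map_id.
have -> : iota m k = iota (1 + m.-1) k by congr iota; lia.
rewrite -iotaD; congr iota; lia.
Qed.

Definition child (a : node) (i : nat) : node := (a.1, i :: a.2).
Definition root_node (b : bool) : node := (b, [::]).

Section TreeExploration.
Context {R : realType} {L : choiceType}.
Implicit Types (vs : seq node) (st : seq nat) (pe : seq (nat * nat)).

Local Notation at_ vs := (nth (root_node true) vs).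

Variable fin : seq node -> seq (nat * nat) -> dtree (node + L).

(** Numbering, stack and pairs evolve exactly as in [explore], so that the values agree without
    error. *)
Fixpoint gw_tree (K l : nat) vs st pe : dtree (node + L) :=
  match st with
  | [::] => fin vs pe
  | p :: st' =>
      match l with
      | 0%N => Leaf false
      | l'.+1 => Query (inl (at_ vs p)) (index_iota 0 K.+1) (fun k =>
          gw_tree K l' (vs ++ [seq child (at_ vs p) i | i <- iota 0 k])
            (iota (size vs) k ++ st') (pe ++ [seq (p, j) | j <- iota (size vs) k]))
      end
  end.

(** Indices outside [st] belong to the vertices whose number of children is known. The last two
    fields make [pe] the list of all edges among the discovered vertices. *)
Record gw_inv vs st pe : Prop := GwInv {
  gw_uniq : uniq vs;
  gw_pairs : tree_pairs (size vs) pe;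
  gw_root : (0, 1)%N \in pe;
  gw_stack : stack_ok (size vs) st;
  gw_size : (1 < size vs)%N;
  gw_root0 : at_ vs 0%N = root_node true;
  gw_root1 : at_ vs 1%N = root_node false;
  gw_parent : forall a i, child a i \in vs ->
    exists q, [/\ (q < size vs)%N, q \notin st & at_ vs q = a];
  gw_child : forall a i, child a i \in vs ->
    exists2 q : nat * nat, q \in pe & at_ vs q.1 = a /\ at_ vs q.2 = child a i;
  gw_edge : forall q : nat * nat, q \in pe -> q = (0, 1)%N \/
    exists i, at_ vs q.2 = child (at_ vs q.1) i }.

(** Once the stack is empty, the two fields say that [vs] lies in the tree and is closed under
    taking children; with the two roots in it, [vs] is the whole tree. *)
Record gw_agree (n : node -> nat) vs st : Prop := GwAgree {
  gw_in : forall a, a \in vs -> tree_vertices n a;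
  gw_all : forall q i, (q < size vs)%N -> q \notin st -> (i < n (at_ vs q))%N ->
    child (at_ vs q) i \in vs }.

Lemma child_inj a : injective (child a).
Proof. by move=> i j []. Qed.

Lemma gw_inv_step vs p st pe k : gw_inv vs (p :: st) pe ->
  gw_inv (vs ++ [seq child (at_ vs p) i | i <- iota 0 k])
    (iota (size vs) k ++ st) (pe ++ [seq (p, j) | j <- iota (size vs) k]).
Proof.
move=> [uvs tp r01 sok sz r0 r1 par chi edg].
have pm : (p < size vs)%N by case/andP: sok => _ /= /andP[].
have pst : p \notin st by case/andP: sok => /= /andP[].
have stm q : q \in st -> (q < size vs)%N.
  by case/andP: sok => _ /= /andP[_ /allP h] /h.
have szn : size (vs ++ [seq child (at_ vs p) i | i <- iota 0 k]) = (size vs + k)%N.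
  by rewrite size_cat size_map size_iota.
have old q : (q < size vs)%N ->
    at_ (vs ++ [seq child (at_ vs p) i | i <- iota 0 k]) q = at_ vs q.
  by move=> qm; rewrite nth_cat qm.
have new i : (i < k)%N ->
    at_ (vs ++ [seq child (at_ vs p) i | i <- iota 0 k]) (size vs + i) =
    child (at_ vs p) i.
  move=> ik; rewrite nth_cat ltnNge leq_addr /= addKn.
  by rewrite (nth_map 0%N) ?size_iota // nth_iota.
(* By [gw_parent] a child already present would have an expanded parent, while [p] is still on the
   stack. *)
have fresh i : child (at_ vs p) i \notin vs.
  apply/negP => /par[q [qm qst /eqP]]; rewrite nth_uniq // => /eqP qp.
  by move: qst; rewrite qp mem_head.
have okpe (q : nat * nat) : q \in pe -> (q.1 < size vs)%N /\ (q.2 < size vs)%N.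
  by case: tp => /allP ok _ /ok; rewrite /pair_ok; lia.
split.
- rewrite cat_uniq uvs /= map_inj_uniq ?iota_uniq ?andbT; last exact: child_inj.
  by apply/hasPn => a /mapP[i _ ->].
- by rewrite szn; apply: tree_pairs_step.
- by rewrite mem_cat r01.
- by rewrite szn; apply: stack_ok_step sok.
- by rewrite szn; lia.
- by rewrite old //; lia.
- by rewrite old.
- move=> a i; rewrite mem_cat => /orP[/par[q [qm qst qa]]|/mapP[j _ [e1 e2 e3]]].
    exists q; split; first by rewrite szn; lia.
      move: qst; rewrite mem_cat inE mem_iota !negb_or => /andP[_ ->].
      by rewrite andbT; lia.
    by rewrite old.
  exists p; split; first by rewrite szn; lia.
    by rewrite mem_cat mem_iota (negbTE pst) orbF; lia.
  by rewrite old //; case: (a) e1 e3 => x y /= -> ->; case: (at_ vs p).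
- move=> a i; rewrite mem_cat => /orP[/chi[q qpe [q1 q2]]|/mapP[j]].
    exists q; first by rewrite mem_cat qpe.
    by have [? ?] := okpe q qpe; rewrite !old.
  rewrite mem_iota => jk [e1 e2 e3].
  exists (p, size vs + j)%N.
    by rewrite mem_cat; apply/orP; right; apply: map_f; rewrite mem_iota; lia.
  rewrite /= old // new; last by lia.
  by rewrite -e2; case: (a) e1 e3 => x y /= -> ->; case: (at_ vs p).
- move=> q; rewrite mem_cat => /orP[qpe|/mapP[j]].
    have [q1 q2] := okpe q qpe; case: (edg q qpe) => [->|[i qi]]; first by left.
    by right; exists i; rewrite !old.
  rewrite mem_iota => jm ->; right; exists (j - size vs)%N => /=.
  have jk : (j - size vs < k)%N by lia.
  by rewrite (old p) // -(new _ jk) subnKC //; case/andP: jm.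
Qed.

Lemma gw_agree_step n vs p st pe : gw_inv vs (p :: st) pe ->
  gw_agree n vs (p :: st) ->
  gw_agree n (vs ++ [seq child (at_ vs p) i | i <- iota 0 (n (at_ vs p))])
    (iota (size vs) (n (at_ vs p)) ++ st).
Proof.
move=> [_ _ _ sok _ _ _ _ _ _] [ain aall].
have pm : (p < size vs)%N by case/andP: sok => _ /= /andP[].
split.
  move=> a; rewrite mem_cat => /orP[/ain //|/mapP[i]].
  rewrite mem_iota /tree_vertices /= => ik ->.
  by have := ain _ (mem_nth (root_node true) pm); rewrite /tree_vertices /= => ->;
    rewrite andbT; case: (at_ vs p) ik.
move=> q i; rewrite size_cat size_map size_iota mem_cat mem_iota negb_or => qm.
move=> /andP[qn qst]; have {}qm : (q < size vs)%N by lia.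
rewrite nth_cat qm => iq; rewrite mem_cat; apply/orP.
have [qp|qp] := eqVneq q p; last first.
  by left; apply: aall => //; rewrite inE negb_or qp.
by right; rewrite qp in iq *; apply: map_f; rewrite mem_iota.
Qed.

Lemma drun_gw_tree {T : Type} (ev : node + L -> nat -> set T) K l vs st pe
    (N : node -> nat) w :
  (forall a k, ev (inl a) k w -> N a = k) ->
  gw_inv vs st pe -> gw_agree N vs st -> drun ev (gw_tree K l vs st pe) w ->
  exists vs' pe', [/\ gw_inv vs' [::] pe', gw_agree N vs' [::] & drun ev (fin vs' pe') w].
Proof.
move=> evN; elim: l vs st pe => [|l IH] vs [|p st] pe inv agr //=.
- by exists vs, pe.
- by exists vs, pe.
case=> k _ [/evN Nk]; apply: IH; first exact: gw_inv_step.
by rewrite -Nk; apply: gw_agree_step agr; exact: inv.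
Qed.

Lemma dval_gw_tree (mu : node + L -> nat -> R) rho K l vs st pe :
  (forall a k, mu (inl a) k = poisson_pmf 1 k) ->
  (forall vs pe, gw_inv vs [::] pe -> dval mu (fin vs pe) = rho (size vs) pe) ->
  gw_inv vs st pe ->
  dval mu (gw_tree K l vs st pe) = explore rho K l (size vs) st pe.
Proof.
move=> mu1 hfin; elim: l vs st pe => [|l IH] vs [|p st] pe inv //=; try exact: hfin.
apply: eq_bigr => k _; rewrite mu1 IH; last exact: gw_inv_step.
by rewrite size_cat size_map size_iota.
Qed.

Definition gw_free (DZ : set L) vs st : set (node + L) :=
  [set k | match k with
    | inl a => ~ exists q, [/\ (q < size vs)%N, q \notin st & at_ vs q = a]
    | inr z => DZ z end].

Lemma dfresh_gw_tree (DZ : set L) K l vs st pe :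
  (forall vs pe, gw_inv vs [::] pe -> dfresh [set k | if k is inr z then DZ z else False] (fin vs pe)) ->
  gw_inv vs st pe -> dfresh (gw_free DZ vs st) (gw_tree K l vs st pe).
Proof.
move=> hfin; have hfin' vs' pe' : gw_inv vs' [::] pe' -> dfresh (gw_free DZ vs' [::]) (fin vs' pe').
  by move=> /hfin; apply: dfreshS => -[].
elim: l vs st pe => [|l IH] vs [|p st] pe inv //=; try exact: hfin'.
have [uvs _ _ sok _ _ _ _ _ _] := inv.
have pm : (p < size vs)%N by case/andP: sok => _ /= /andP[].
have pst : p \notin st by case/andP: sok => /= /andP[].
split; last 1 first.
- move=> k _; apply: dfreshS (IH _ _ _ (gw_inv_step k inv)).
  have qold q : (q < size vs)%N -> q \notin st -> [/\
      (q < size (vs ++ [seq child (at_ vs p) i | i <- iota 0 k]))%N,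
      q \notin iota (size vs) k ++ st &
      at_ (vs ++ [seq child (at_ vs p) i | i <- iota 0 k]) q = at_ vs q].
    move=> qm qst; rewrite size_cat mem_cat mem_iota (negbTE qst) orbF nth_cat qm.
    by split=> //; lia.
  move=> [a|z] /= h; split => //.
    move=> [q [qm qst qa]]; apply: h; exists q; rewrite -qa; apply: qold => //.
    by move: qst; rewrite inE negb_or => /andP[].
  by move=> [ap]; apply: h; exists p; rewrite ap; apply: qold.
- move=> [q [qm qst /eqP]]; rewrite nth_uniq // => /eqP qp.
  by move: qst; rewrite qp mem_head.
- exact: (iota_uniq 0 K.+1).
Qed.

Lemma gw_inv0 : gw_inv [:: root_node true; root_node false] [:: 0; 1]%N [:: (0, 1)%N].
Proof.
split => //=.
- by move=> a i; rewrite !inE /child => /orP[] /eqP.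
- by move=> a i; rewrite !inE /child => /orP[] /eqP.
- by move=> q; rewrite inE => /eqP ->; left.
Qed.

Lemma gw_agree0 n : gw_agree n [:: root_node true; root_node false] [:: 0; 1]%N.
Proof.
split; first by move=> a; rewrite !inE => /orP[] /eqP ->.
by move=> [|[|q]].
Qed.

End TreeExploration.

Lemma countable_bigcap_measurable {d : measure_display} {T : measurableType d}
    (C : countType) (F : C -> set T) :
  (forall c, measurable (F c)) -> measurable (\bigcap_c F c).
Proof.
move=> mF; rewrite -[X in measurable X]setCK setC_bigcap; apply: measurableC.
apply: countable_bigcupT_measurable; first exact: countableP.
by move=> c; apply: measurableC.
Qed.

(** * Measurability and the lower bound for the Galton-Watson tree *)

Section TreeEdges.
Implicit Types n : node -> nat.

Lemma tree_vertices_parent n b i s :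
  tree_vertices n (b, i :: s) -> tree_vertices n (b, s).
Proof. by rewrite /tree_vertices /= => /andP[]. Qed.

Lemma tree_edges_vertices n f v : tree_edges n f -> v \in f -> tree_vertices n v.
Proof.
move=> [->|[b [i [s [bs ->]]]]]; rewrite !inE => /orP[] /eqP -> //.
exact: tree_vertices_parent bs.
Qed.

Lemma tree_edges_finite n (E : {fset {fset node}}) : [set` E] = tree_edges n ->
  finite_set (tree_vertices n).
Proof.
move=> EE; apply: (@sub_finite_set _ _ [set` (\bigcup_(f <- E) f)%fset]); last first.
  exact: finite_fset.
move=> [b s] bs /=.
have inE' f v : f \in E -> v \in f -> v \in (\bigcup_(f <- E) f)%fset.
  move=> fE vf; apply/bigfcupP; exists f => //.
  by rewrite fE.
case: s bs => [|i s] bs.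
  apply: (inE' root_edge); last by case: b {bs}; rewrite !inE eqxx ?orbT.
  have : [set` E] root_edge by rewrite EE; left.
  by [].
apply: (inE' [fset ((b, s) : node); ((b, i :: s) : node)]%fset); last first.
  by rewrite !inE eqxx orbT.
have : [set` E] [fset ((b, s) : node); ((b, i :: s) : node)]%fset.
  by rewrite EE; right; exists b, i, s.
by [].
Qed.

Lemma possible_tree_edgesP b i s :
  possible_tree_edges [fset ((b, s) : node); ((b, i :: s) : node)]%fset.
Proof.
(* Every vertex gets a number of children exceeding all the indices on the path. *)
exists (fun=> (\max_(j <- i :: s) j).+1) => //; right; exists b, i, s; split => //.
rewrite /tree_vertices; set c := _.+1.
have : forall j, j \in i :: s -> (j < c)%N by move=> j js; rewrite ltnS leq_bigmax_seq.
change (b, i :: s).2 with (i :: s); change (b, i :: s).1 with b.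
elim: (i :: s) => //= j s' IH h; rewrite h ?mem_head //= IH // => k ks.
by apply: h; rewrite inE ks orbT.
Qed.

Lemma possible_root_edge : possible_tree_edges root_edge.
Proof. by exists (fun=> 0%N) => //; left. Qed.

Lemma possible_tree_edges_pair f : possible_tree_edges f ->
  exists a b, f = [fset a; b]%fset.
Proof.
move=> [n _ [->|[b [i [s [_ ->]]]]]]; last by exists (b, s), (b, i :: s).
by exists (true, [::]), (false, [::]).
Qed.

End TreeEdges.

Section TreeSide.
Context {R : realType} {d : measure_display} {T : measurableType d}.
Context (o : ordering) (P : probability T R) (N : node -> {RV P >-> nat}).
Variable (tau : T -> {fset node} -> R).
Hypothesis hT : tree_model o N tau.

Let matched := [set w | root_edge_matched (fun a => N a w) (tau w)].

Lemma measurable_tree_vertices a :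
  measurable [set w | tree_vertices (fun c => N c w) a].
Proof.
case: a => b s; rewrite /tree_vertices /=; elim: s => [|i s IH] /=.
  by rewrite (_ : [set _ | _] = setT) // predeqE.
rewrite (_ : [set _ | _] = (N (b, s) @^-1` [set k | (i < k)%N]) `&`
    [set w | in_tree_rec (fun c => N c w) b s]); last first.
  by apply/seteqP; split => w /= /andP.
by apply: measurableI => //; exact: measurable_funPTI.
Qed.

Lemma measurable_tree_edges (E : {fset {fset node}}) :
  measurable [set w | [set` E] = tree_edges (fun a => N a w)].
Proof.
have mf f : measurable [set w | tree_edges (fun a => N a w) f].
  have [->|fr] := eqVneq f root_edge.
    by rewrite (_ : [set _ | _] = setT) // predeqE => w; split => // _; left.
  rewrite (_ : [set _ | _] = \bigcup_(c in [set: bool * nat * seq nat])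
    (if f == [fset ((c.1.1, c.2) : node); ((c.1.1, c.1.2 :: c.2) : node)]%fset
     then [set w | tree_vertices (fun a => N a w) (c.1.1, c.1.2 :: c.2)] else set0)).
    apply: countable_bigcupT_measurable; first exact: countableP.
    move=> c; case: ifP => _; [exact: measurable_tree_vertices|exact: measurable0].
  apply/seteqP; split => w /=.
    case=> [e|[b [i [s [bs ->]]]]]; first by rewrite e eqxx in fr.
    by exists (b, i, s) => //=; rewrite eqxx.
  move=> [[[b i] s] _ /=]; case: eqP => // -> bs.
  by right; exists b, i, s.
rewrite (_ : [set _ | _] = \bigcap_(f in [set: {fset node}])
    (if f \in E then [set w | tree_edges (fun a => N a w) f]
     else ~` [set w | tree_edges (fun a => N a w) f])).
  apply: countable_bigcap_measurable => f; case: ifP => _ //.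
  exact: measurableC.
apply/seteqP; split => w /=.
  move=> e f _; case: ifPn => fE /=; rewrite -e //=.
  exact/negP.
move=> h; apply/seteqP; split => f /=.
  by move=> fE; have := h f I; rewrite fE.
by move=> ft; have := h f I; case: ifP => // _ /(_ ft).
Qed.

(** There are countably many finite edge sets. On the event that the tree has a given one, the
    outcome depends on finitely many comparisons of [tau], for which the events [A] stand in because
    the vertex set is finite. *)
Lemma measurable_root_edge_matched : measurable matched.
Proof.
have [_ ro] := hT.
have [Z [DZ [_ _ _ _ [A [mA leA]]]]] := random_orderP possible_tree_edges_pair ro.
rewrite (_ : matched = \bigcup_(E in [set: {fset {fset node}}])
    ([set w | [set` E] = tree_edges (fun a => N a w)] `&`
     [set w | root_edge \in foldl (greedy_step predT) [::]
        (sort (fun f g => `[< A (f, g) w >]) E)])).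
  apply: countable_bigcupT_measurable; first exact: countableP.
  move=> E; apply: measurableI; first exact: measurable_tree_edges.
  apply: (@measurable_bools _ _ _ [seq (f, g) | f <- E, g <- E]
    (fun fg w => `[< A fg w >])) => [fg _|w w' ww'].
    rewrite (_ : [set _ | _] = A fg) //.
    by apply/seteqP; split => w /asboolP.
  suff -> : sort (fun f g => `[< A (f, g) w >]) E =
            sort (fun f g => `[< A (f, g) w' >]) E by [].
  apply: (@eq_in_sort _ (mem E)); last exact/allP.
  by move=> f g fE gE; apply: (ww' (f, g)); apply: allpairs_f.
have sortE w (E : {fset {fset node}}) : [set` E] = tree_edges (fun a => N a w) ->
    greedy (tau w) E =
    foldl (greedy_step predT) [::] (sort (fun f g => `[< A (f, g) w >]) E).
  move=> EE; rewrite /greedy /greedy_crs; congr foldl.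
  apply: (@eq_in_sort _ (mem E)); last exact/allP.
  have Et f : f \in E -> tree_edges (fun a => N a w) f by move=> fE; rewrite -EE.
  move=> f g fE gE; apply: leA.
  - exact: tree_edges_finite EE.
  - by exists (fun a => N a w) => //; apply: Et.
  - by exists (fun a => N a w) => //; apply: Et.
  - by move=> v; apply: tree_edges_vertices; apply: Et.
  - by move=> v; apply: tree_edges_vertices; apply: Et.
apply/seteqP; split => w /=.
  by move=> [E EE rE]; exists E => //; split => //=; rewrite -sortE.
by move=> [E _ [/= EE rE]]; exists E => //; rewrite sortE.
Qed.

Lemma gw_inv_possible vs st pe p : gw_inv vs st pe -> p \in pe ->
  possible_tree_edges (edge_of (nth (root_node true) vs) p).
Proof.
move=> inv /(gw_edge inv)[->|[i e]].
  by rewrite /edge_of /= (gw_root0 inv) (gw_root1 inv); exact: possible_root_edge.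
rewrite /edge_of e; case: (nth _ vs p.1) => b s; exact: possible_tree_edgesP.
Qed.

(** A successful run reveals the whole finite tree and the order of its labels, hence the outcome.
    No error term appears: the queried variables are exactly Poisson(1) and exactly uniform on the
    cells. *)
Lemma tree_lower_bound n b K l :
  explore (root_val o n b) K l 2 [:: 0; 1]%N [:: (0, 1)%N] <=
  fine (P (if b then matched else ~` matched)).
Proof.
have [Npois ro] := hT.
have [Z [DZ [Zu Zind DZlab tauZ _]]] := random_orderP possible_tree_edges_pair ro.
pose fin vs pe : dtree (node + label o node) :=
  root_tree o n b (nth (root_node true) vs) (size vs) pe.
pose mu k a := fine (P (obs_event N id Z n k a)).
have inj vs st pe : gw_inv vs st pe -> forall i j, (i < size vs)%N -> (j < size vs)%N ->
    nth (root_node true) vs i = nth (root_node true) vs j -> i = j.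
  by move=> inv i j im jm /eqP; rewrite (nth_uniq _ _ _ (gw_uniq inv)) // => /eqP.
have mm := measurable_root_edge_matched.
have -> : explore (root_val o n b) K l 2 [:: 0; 1]%N [:: (0, 1)%N] =
    dval mu (gw_tree fin K l [:: root_node true; root_node false] [:: 0; 1]%N [:: (0, 1)%N]).
  rewrite (dval_gw_tree (rho := root_val o n b)) //.
  - by move=> a k; rewrite /mu /= Npois.
  - move=> vs pe inv; apply: dval_root_tree => i im; apply: Zu.
    apply: (DZlab _ (size vs)) => //; first exact: gw_pairs inv.
    by move=> p; exact: (gw_inv_possible inv).
  - exact: gw_inv0.
have := @obs_lower_bound R d T P node (label o node) _ _ N id Z n setT DZ _ Zind
  (if b then matched else ~` matched)
  (gw_tree fin K l [:: root_node true; root_node false] [:: 0; 1]%N [:: (0, 1)%N])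
  (gw_free DZ [:: root_node true; root_node false] [:: 0; 1]%N) fset0 (fun=> 0%N).
rewrite big_seq_fset0 mul1r (_ : \bigcap_(k in _) _ = setT); last first.
  by rewrite (_ : [set` _] = set0) ?bigcap_set0 //; apply/seteqP; split.
rewrite setIT; apply => //.
- by case: (b) => //; exact: measurableC.
- by move=> [a|z].
- apply: dfresh_gw_tree gw_inv0 => vs pe inv.
  apply: dfresh_root_tree; first exact: inj inv.
    exact: gw_pairs inv.
  move=> i im; apply: (DZlab _ (size vs)) => //; first exact: gw_pairs inv.
  by move=> p; exact: (gw_inv_possible inv).
move=> w _ rw0.
have evN a k : obs_event N id Z n (inl a) k w -> N a w = k by [].
have [vs [pe [inv agr rw]]] := drun_gw_tree evN gw_inv0 (gw_agree0 _) rw0.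
set phi := nth (root_node true) vs in rw.
(* The nontrivial inclusion goes by induction on the path from the root: with an empty stack every
   discovered vertex has all its children in [vs]. *)
have vsP a : a \in vs = `[< tree_vertices (fun c => N c w) a >].
  apply/idP/asboolP; first exact: gw_in agr a.
  case: a => c s; elim: s => [|i s IH] /=.
    move=> _; have h := gw_size inv.
    case: c; first by rewrite -[(true, _)](gw_root0 inv); apply: mem_nth; exact: ltnW h.
    by rewrite -[(false, _)](gw_root1 inv); apply: mem_nth.
  move=> cs; have cs' := tree_vertices_parent cs.
  have [q qm qa] := nthP (root_node true) (IH cs').
  have := gw_all agr (q := q) (i := i) qm; rewrite qa; apply => //.
  by move: cs; rewrite /tree_vertices /= => /andP[].
pose E := [fset f in map (edge_of phi) pe]%fset.
have EP f : (f \in E) = (f \in map (edge_of phi) pe) by rewrite !inE.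
have rootE : edge_of phi (0, 1)%N = root_edge.
  by rewrite /edge_of /phi /= (gw_root0 inv) (gw_root1 inv).
have EE : [set` E] = tree_edges (fun a => N a w).
  apply/seteqP; split => f /=; rewrite EP.
    move=> /mapP[p ppe ->]; have [->|[i e]] := gw_edge inv ppe.
      by rewrite rootE; left.
    right; rewrite /edge_of /phi e.
    have : child (nth (root_node true) vs p.1) i \in vs.
      rewrite -e mem_nth //; have [/allP ok _] := gw_pairs inv.
      by case/andP: (ok _ ppe).
    rewrite vsP => /asboolP; case: (nth _ vs p.1) => c s cs.
    by exists c, i, s; split.
  move=> [->|[c [i [s [cs ->]]]]]; first by rewrite -rootE; apply: map_f; exact: gw_root inv.
  have := vsP (c, i :: s); rewrite asboolT // => /(gw_child inv (a := (c, s)))[q qpe [q1 q2]].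
  by apply/mapP; exists q => //; rewrite /edge_of /phi q1 q2.
have gE : (root_edge \in greedy (tau w) E) = b.
  rewrite -rootE; apply: (drun_root_tree (phi := phi) (m := size vs) (pe := pe) _ _ _ _ _ _ rw).
  - exact: inj inv.
  - exact: gw_pairs inv.
  - exact: gw_root inv.
  - by move=> p ppe; rewrite EP; split => //; apply: map_f.
  - by move=> f p v; rewrite EP.
  - apply: (tauZ w phi (size vs) pe).
    + exact: gw_pairs inv.
    + by move=> p; exact: (gw_inv_possible inv).
    + exact: tree_edges_finite EE.
    + by move=> i im; apply: (gw_in agr); rewrite mem_nth.
case: (b) gE => gE; first by exists E => //.
(* [root_edge_matched] is existential in the edge set, so its negation needs that this set is
   unique. *)
move=> [E' E'E]; suff -> : E' = E by rewrite gE.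
have eqE : [set` E'] = [set` E] by rewrite E'E EE.
by apply/fsetP => f; apply/idP/idP => fE; [have : [set` E] f by rewrite -eqE|have : [set` E'] f by rewrite eqE].
Qed.

End TreeSide.

(** * Querying the edges at one vertex *)

Section Scan.
Context {R : realType} {V L : choiceType}.
Implicit Types (c : V) (f : {fset V}) (l : seq {fset V}) (acc bad : seq V).

Definition other c f : V := head c [seq v <- f | v != c].

Lemma otherP c f : #|` f| = 2%N -> c \in f ->
  f = [fset c; other c f]%fset /\ other c f != c.
Proof.
move=> f2 cf; have /cardfs1P[y fy] : #|` (f `\ c)%fset| == 1%N.
  by have := cardfsD1 c f; rewrite cf f2 add1n => -[<-].
have inF v : (v \in [seq v <- f | v != c]) = (v == y).
  by rewrite mem_filter -in_fsetD1 fy inE.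
have oy : other c f = y.
  rewrite /other; move: inF; case: [seq v <- f | v != c] => [|z s] h /=.
    by have := h y; rewrite eqxx.
  by apply/eqP; rewrite -h mem_head.
have : y \in (f `\ c)%fset by rewrite fy inE.
rewrite in_fsetD1 => /andP[yc _]; split; last by rewrite oy.
by rewrite oy -fy fsetD1K.
Qed.

(** [bad] holds the vertices waiting on the stack: an active edge to one of them closes a cycle, and
    the run is given up. *)
Fixpoint scan c bad l acc (cont : seq V -> dtree ({fset V} + L)) :
    dtree ({fset V} + L) :=
  match l with
  | [::] => cont acc
  | f :: l' => Query (inl f) [:: 0; 1]%N (fun a =>
      if a == 0%N then scan c bad l' acc cont
      else if other c f \in bad then Leaf false
      else scan c bad l' (rcons acc (other c f)) cont)
  end.

Lemma drun_scan {T : Type} (ev : {fset V} + L -> nat -> set T) c bad l acc cont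
    (act : pred {fset V}) w :
  (forall f a, ev (inl f) a w -> act f = a :> nat) ->
  drun ev (scan c bad l acc cont) w ->
  drun ev (cont (acc ++ map (other c) [seq f <- l | act f])) w /\
  all (fun f => other c f \notin bad) [seq f <- l | act f].
Proof.
move=> evP; elim: l acc => [|f l IH] acc /=; first by rewrite cats0.
case=> a; rewrite !inE => /orP[] /eqP -> [/evP] /=; case: (act f) => //= _.
  exact: IH.
by case: ifP => //= _ /IH; rewrite cat_rcons.
Qed.

Lemma dfresh_scan (S : set ({fset V} + L)) c bad l acc cont :
  uniq l -> (forall f, f \in l -> S (inl f)) ->
  (forall s, subseq s l -> all (fun f => other c f \notin bad) s ->
     dfresh (S `&` [set k | if k is inl f then f \notin l else True])
       (cont (acc ++ map (other c) s))) ->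
  dfresh S (scan c bad l acc cont).
Proof.
elim: l acc S => [|f l IH] acc S /=.
  move=> _ _ h; have := h [::] erefl erefl; rewrite cats0; apply: dfreshS.
  by move=> k [].
move=> /andP[fl ul] lS h; split => //; first by apply: lS; rewrite mem_head.
have lS' g : g \in l -> (S `\ inl f) (inl g).
  move=> gl; split; first by apply: lS; rewrite inE gl orbT.
  by move=> [e]; rewrite -e gl in fl.
have sub : (S `&` [set k | if k is inl g then g \notin f :: l else True]) `<=`
    ((S `\ inl f) `&` [set k | if k is inl g then g \notin l else True]).
  move=> [g|z] [Sk /=]; last by move=> _; split => //; split.
  rewrite inE negb_or => /andP[gf gl]; split => //; split => // -[e].
  by rewrite e eqxx in gf.
move=> a; rewrite !inE => /orP[] /eqP -> /=.
  apply: IH => // s sl sok; apply: dfreshS sub _; apply: h => //.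
  exact: subseq_trans sl (subseq_cons _ _).
case: ifPn => // fok; apply: IH => // s sl sok.
rewrite cat_rcons; apply: dfreshS sub _.
apply: (h (f :: s)); first by rewrite /= eqxx.
by rewrite /= fok.
Qed.

(* Le Cam's argument, one edge at a time. *)
Lemma dval_scan (mu : {fset V} + L -> nat -> R) (x : {fset V} -> R) K B e0 c bad l acc
    cont (ok := fun f => other c f \notin bad) :
  (forall f, f \in l -> mu (inl f) 0%N = 1 - x f) ->
  (forall f, f \in l -> mu (inl f) 1%N = x f) ->
  (forall f, f \in l -> 0 <= x f <= 1) ->
  (forall k, 0 <= B k <= 1) -> 0 <= e0 ->
  \sum_(f <- l | ok f) x f <= 1 ->
  (forall s, subseq s l -> all ok s ->
     B (size acc + size s)%N - e0 <= dval mu (cont (acc ++ map (other c) s))) ->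
  pois_mean K B (\sum_(f <- l | ok f) x f) (size acc)
    - 4 * K.+1%:R * (\sum_(f <- l | ok f) x f ^+ 2)
    - K.+1%:R * (\sum_(f <- l | ~~ ok f) x f) - e0 <=
  dval mu (scan c bad l acc cont).
Proof.
move=> mu0 mu1 x01 B01 e00.
elim: l acc mu0 mu1 x01 => [|f l IH] acc mu0 mu1 x01 la1 h.
  rewrite !big_nil pois_mean0 !mulr0 !subr0.
  by have := h [::] erefl erefl; rewrite cats0 addn0.
have fl : f \in f :: l by rewrite mem_head.
have sl g : g \in l -> g \in f :: l by rewrite inE orbC => ->.
have /andP[xf0 xf1] := x01 f fl.
have {}IH acc' := IH acc' (fun g gl => mu0 g (sl g gl)) (fun g gl => mu1 g (sl g gl))
  (fun g gl => x01 g (sl g gl)).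
have S0 : 0 <= \sum_(g <- l | ok g) x g.
  by rewrite big_seq_cond sumr_ge0 // => g /andP[gl _]; case/andP: (x01 g (sl _ gl)).
have S2 : 0 <= \sum_(g <- l | ok g) x g ^+ 2 by rewrite sumr_ge0 // => g _; exact: sqr_ge0.
have S3 : 0 <= \sum_(g <- l | ~~ ok g) x g.
  by rewrite big_seq_cond sumr_ge0 // => g /andP[gl _]; case/andP: (x01 g (sl _ gl)).
have K0 : 0 <= K.+1%:R :> R by rewrite ler0n.
rewrite /= !big_cons big_nil addr0 /= mu0 // mu1 //.
have la1' : \sum_(g <- l | ok g) x g <= 1.
  by apply: le_trans la1; rewrite big_cons; case: ifP => // _; rewrite lerDr.
have IH0 := IH acc la1'.
have {}IH0 : pois_mean K B (\sum_(g <- l | ok g) x g) (size acc)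
    - 4 * K.+1%:R * (\sum_(g <- l | ok g) x g ^+ 2)
    - K.+1%:R * (\sum_(g <- l | ~~ ok g) x g) - e0 <= dval mu (scan c bad l acc cont).
  apply: IH0 => s ss sok; apply: h => //; exact: subseq_trans ss (subseq_cons _ _).
have la01 : 0 <= \sum_(g <- l | ok g) x g <= 1 by rewrite S0 la1'.
set la := \sum_(g <- l | ok g) x g in la1' IH0 S0 IH la01 *.
set s2 := \sum_(g <- l | ok g) x g ^+ 2 in IH0 S2 IH *.
set s3 := \sum_(g <- l | ~~ ok g) x g in IH0 S3 IH *.
set E4 := 4 * K.+1%:R * s2 in IH0 IH.
set E1 := K.+1%:R * s3 in IH0 IH.
have E40 : 0 <= E4 by rewrite /E4 !mulr_ge0.
have E10 : 0 <= E1 by rewrite /E1 mulr_ge0.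
case: (boolP (ok f)) => okf /=.
  rewrite (negbTE okf) /=.
  have IH1 := IH (rcons acc (other c f)) la1'.
  rewrite size_rcons in IH1.
  have {}IH1 : pois_mean K B la (size acc).+1 - E4 - E1 - e0 <=
      dval mu (scan c bad l (rcons acc (other c f)) cont).
    apply: IH1 => s ss sok; rewrite cat_rcons addSnnS.
    by apply: (h (f :: s)); rewrite /= ?eqxx ?okf.
  have la1f : la + x f <= 1 by move: la1; rewrite big_cons okf addrC.
  have st := pois_mean_step K (size acc) B01 S0 xf0 la1f.
  rewrite [x f + la]addrC mulrDr.
  have h0 : (1 - x f) * (pois_mean K B la (size acc) - E4 - E1 - e0) <=
      (1 - x f) * dval mu (scan c bad l acc cont).
    by rewrite ler_wpM2l // subr_ge0.
  have h1 := ler_wpM2l xf0 IH1.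
  rewrite -/E4 -/E1; lra.
(* This edge leads to a waiting vertex, so its activity is worth 0; the loss is at most [x f] times
   the bound [K.+1] on [pois_mean]. *)
rewrite negbK in okf; rewrite okf /= mulr0 addr0.
have /andP[p0 p1] := pois_mean_bounds K (size acc) B01 la01.
have h0 : (1 - x f) * (pois_mean K B la (size acc) - E4 - E1 - e0) <=
    (1 - x f) * dval mu (scan c bad l acc cont).
  by rewrite ler_wpM2l // subr_ge0.
have h1 : x f * pois_mean K B la (size acc) <= K.+1%:R * x f.
  by rewrite mulrC ler_wpM2r.
have h2 : 0 <= x f * (E4 + E1 + e0) by rewrite mulr_ge0 // !addr_ge0.
rewrite mulrDr -/E4 -/E1; lra.
Qed.

End Scan.

Lemma sum_uniq_sub {R : realType} (I : eqType) (s t : seq I) (p : pred I) (x : I -> R) :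
  uniq s -> uniq t -> {subset s <= t} -> (forall i, i \in t -> 0 <= x i) ->
  \sum_(i <- s | p i) x i <= \sum_(i <- t | p i) x i.
Proof.
move=> us ut st x0.
have ps : perm_eq s [seq i <- t | i \in s].
  apply: uniq_perm => //; first exact: filter_uniq.
  by move=> i; rewrite mem_filter; apply/idP/andP => [is_|[]//]; split => //; exact: st.
rewrite (perm_big _ ps) big_filter_cond /=.
rewrite [leRHS](bigID (fun i => i \in s)) /= ler_wpDr //.
  by rewrite big_seq_cond sumr_ge0 // => i /andP[/x0].
by rewrite le_eqVlt; apply/orP; left; apply/eqP; apply: eq_bigl => i; rewrite andbC.
Qed.

Lemma sum_le_size {R : realType} (I : eqType) (s : seq I) (p : pred I) (x : I -> R) (eps : R) m :
  (forall i, i \in s -> x i <= eps) -> 0 <= eps ->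
  (size [seq i <- s | p i] <= m)%N -> \sum_(i <- s | p i) x i <= m%:R * eps.
Proof.
move=> xe e0 sm; rewrite -big_filter.
apply: (@le_trans _ _ (\sum_(i <- [seq i <- s | p i]) eps)).
  rewrite big_seq [leRHS]big_seq; apply: ler_sum => i.
  by rewrite mem_filter => /andP[_ /xe].
rewrite big_const_seq count_predT iter_addr_0 -[X in X <= _]mulr_natl.
by rewrite ler_wpM2r // ler_nat.
Qed.

(** * Exploration of a component of the graph *)

Section GraphExploration.
Context {R : realType} {V : finType} {L : choiceType}.
Variables (E : {fset {fset V}}) (x : {fset V} -> R) (eps : R).
Hypotheses (E_input : is_input E x) (E_regular : one_regular E x).
Hypothesis x_le : forall f, f \in E -> x f <= eps.
Hypothesis eps_ge0 : 0 <= eps.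
Variables (e : {fset V}) (v0 : V).
Implicit Types (l : seq {fset V}) (vs : seq V) (st : seq nat) (pe : seq (nat * nat)).

Local Notation at_ vs := (nth v0 vs).

Variable fin : seq V -> seq (nat * nat) -> dtree ({fset V} + L).

(** Only stacked vertices are passed to [scan] as forbidden: no unqueried edge reaches an explored
    vertex, because all its edges left [l] when it was scanned. *)
Fixpoint graph_tree (K n : nat) l vs st pe : dtree ({fset V} + L) :=
  match st with
  | [::] => fin vs pe
  | p :: st' =>
      match n with
      | 0%N => Leaf false
      | n'.+1 => scan (at_ vs p) (map (at_ vs) st') [seq f <- l | at_ vs p \in f] [::]
          (fun Y => if (size Y <= K)%N then
             graph_tree K n' [seq f <- l | at_ vs p \notin f] (vs ++ Y)
               (iota (size vs) (size Y) ++ st')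
               (pe ++ [seq (p, j) | j <- iota (size vs) (size Y)])
             else Leaf false)
      end
  end.

(* [l] lists the edges that have not been queried yet; [B] counts the edges at
   an unexplored vertex that may be missing from [l]. *)
Record graph_inv l vs st pe (B : nat) : Prop := GraphInv {
  gi_uniq : uniq vs;
  gi_pairs : tree_pairs (size vs) pe;
  gi_root : (0, 1)%N \in pe;
  gi_stack : stack_ok (size vs) st;
  gi_rootE : edge_of (at_ vs) (0, 1)%N = e;
  gi_luniq : uniq l;
  gi_lE : {subset l <= E};
  gi_le : e \notin l;
  gi_open : forall f i, f \in l -> (i < size vs)%N -> at_ vs i \in f -> i \in st;
  gi_edge : forall q, q \in pe -> edge_of (at_ vs) q \in E;
  gi_mass : forall c, (forall i, (i < size vs)%N -> at_ vs i = c -> i \in st) ->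
    1 - B%:R * eps <= \sum_(f <- l | c \in f) x f }.

Record graph_agree (act : pred {fset V}) l vs pe : Prop := GraphAgree {
  ga_act : forall q, q \in pe -> act (edge_of (at_ vs) q);
  ga_all : forall f, f \in E -> f \notin l -> act f -> f \in map (edge_of (at_ vs)) pe }.

Lemma E_otherP f c : f \in E -> c \in f -> f = [fset c; other c f]%fset /\ other c f != c.
Proof. by move=> fE; apply: otherP; case: E_input => h _; exact: h. Qed.

Lemma other_in f c : f \in E -> c \in f -> other c f \in f.
Proof. by move=> fE cf; rewrite {2}(E_otherP fE cf).1 !inE eqxx orbT. Qed.

Section Step.
Variables (l : seq {fset V}) (vs : seq V) (p : nat) (st : seq nat)
  (pe : seq (nat * nat)) (B : nat) (s : seq {fset V}).
Hypothesis inv : graph_inv l vs (p :: st) pe B.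
Hypothesis s_sub : subseq s [seq f <- l | at_ vs p \in f].
Hypothesis s_ok : all (fun f => other (at_ vs p) f \notin map (at_ vs) st) s.

Let c := at_ vs p.
Let Y := map (other c) s.

Let sP f : f \in s -> [/\ f \in l, f \in E & c \in f].
Proof.
move/(mem_subseq s_sub); rewrite mem_filter => /andP[cf fl].
by split => //; exact: (gi_lE inv).
Qed.

Let pm : (p < size vs)%N.
Proof. by case/andP: (gi_stack inv) => _ /= /andP[]. Qed.

Let pst : p \notin st.
Proof. by case/andP: (gi_stack inv) => /= /andP[]. Qed.

Let old q : (q < size vs)%N -> at_ (vs ++ Y) q = at_ vs q.
Proof. by move=> qm; rewrite nth_cat qm. Qed.

Let okpe (q : nat * nat) : q \in pe -> (q.1 < size vs)%N /\ (q.2 < size vs)%N.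
Proof. by case: (gi_pairs inv) => /allP ok _ /ok; rewrite /pair_ok; lia. Qed.

Let old_edge (q : nat * nat) : q \in pe -> edge_of (at_ (vs ++ Y)) q = edge_of (at_ vs) q.
Proof. by move=> /okpe[q1 q2]; rewrite /edge_of !old. Qed.

Let new_edge i : (i < size s)%N ->
  edge_of (at_ (vs ++ Y)) (p, size vs + i)%N = nth fset0 s i.
Proof.
move=> im; have [_ fE cf] := sP (mem_nth fset0 im).
rewrite /edge_of /= old // nth_cat ltnNge leq_addr /= addKn.
by rewrite (nth_map fset0) // -(E_otherP fE cf).1.
Qed.

(** The far ends found by the scan are new: [gi_open] leaves only stacked or undiscovered vertices,
    and the scan excluded the stacked ones. [B] grows by one because scanning [c] removes at most
    one edge at any other vertex. *)
Lemma graph_inv_step : graph_inv [seq f <- l | c \notin f] (vs ++ Y)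
  (iota (size vs) (size Y) ++ st) (pe ++ [seq (p, j) | j <- iota (size vs) (size Y)]) B.+1.
Proof.
have szY : size Y = size s by rewrite size_map.
have uvs := gi_uniq inv.
split.
- rewrite cat_uniq uvs /=; apply/andP; split.
    apply/hasPn => y /mapP[f fs ->]; have [fl fE cf] := sP fs.
    apply/negP => /(nthP v0)[i im yi].
    have := gi_open inv fl im; rewrite yi => /(_ (other_in fE cf)).
    rewrite inE => /orP[/eqP ip|ist].
      by have [_] := E_otherP fE cf; rewrite -yi ip eqxx.
    by have := allP s_ok _ fs; rewrite -/c -yi map_f.
  rewrite map_inj_in_uniq; first exact: subseq_uniq s_sub (filter_uniq _ (gi_luniq inv)).
  move=> f g /sP[_ fE cf] /sP[_ gE cg] fg.
  by rewrite (E_otherP fE cf).1 (E_otherP gE cg).1 fg.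
- by rewrite size_cat; apply: tree_pairs_step => //; exact: gi_pairs inv.
- by rewrite mem_cat (gi_root inv).
- by rewrite size_cat; apply: stack_ok_step (gi_stack inv).
- by rewrite old_edge ?(gi_rootE inv) //; exact: gi_root inv.
- exact: filter_uniq (gi_luniq inv).
- by move=> f; rewrite mem_filter => /andP[_ /(gi_lE inv)].
- by rewrite mem_filter negb_and (gi_le inv) orbT.
- move=> f i; rewrite mem_filter size_cat => /andP[cf fl] im.
  rewrite mem_cat mem_iota.
  have [im'|im'] := ltnP i (size vs); last by move=> _; rewrite im.
  rewrite old // => fi; have := gi_open inv fl im' fi.
  rewrite inE => /orP[/eqP ip|->]; last by rewrite orbT.
  by move: cf; rewrite /c -ip fi.
- move=> q; rewrite mem_cat => /orP[qpe|/mapP[j]].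
    by rewrite old_edge //; exact: gi_edge inv _ qpe.
  rewrite mem_iota => jm ->.
  have js : (j - size vs < size s)%N by rewrite -szY; lia.
  have := new_edge js; rewrite subnKC; last by case/andP: jm.
  by move=> ->; have [] := sP (mem_nth fset0 js).
move=> c' hc'.
have cc' : c != c'.
  apply/eqP => cc'; have := hc' p; rewrite old // size_cat => /(_ _ cc').
  by rewrite mem_cat mem_iota (negbTE pst) orbF; lia.
have hc'0 i : (i < size vs)%N -> at_ vs i = c' -> i \in p :: st.
  move=> im ic'; have := hc' i; rewrite old // size_cat mem_cat mem_iota inE.
  by move=> /(_ _ ic'); lia.
have := gi_mass inv hc'0.
rewrite (bigID (fun f => c \in f)) /= => m1.
(* The graph is simple: the only edge that can contain both is [[fset c; c']]. *)
have small : \sum_(f <- l | (c' \in f) && (c \in f)) x f <= 1%:R * eps.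
  apply: sum_le_size => //; first by move=> f /(gi_lE inv)/x_le.
  apply: (@uniq_leq_size _ _ [:: [fset c; c']%fset]).
    exact: filter_uniq (gi_luniq inv).
  move=> f; rewrite mem_filter inE => /andP[/andP[c'f cf] /(gi_lE inv) fE].
  have [ef oc] := E_otherP fE cf.
  have /eqP -> : c' == other c f.
    by move: c'f; rewrite {1}ef !inE [c' == c]eq_sym (negbTE cc').
  by rewrite -ef.
rewrite big_filter_cond /=.
have -> : \sum_(f <- l | (c \notin f) && (c' \in f)) x f =
          \sum_(f <- l | (c' \in f) && (c \notin f)) x f.
  by apply: eq_bigl => f; rewrite andbC.
have -> : B.+1%:R = B%:R + 1 :> R by rewrite natr1.
lra.
Qed.

Lemma graph_agree_step (act : pred {fset V}) :
  s = [seq f <- [seq f <- l | c \in f] | act f] ->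
  graph_agree act l vs pe ->
  graph_agree act [seq f <- l | c \notin f] (vs ++ Y)
    (pe ++ [seq (p, j) | j <- iota (size vs) (size Y)]).
Proof.
have szY : size Y = size s by rewrite size_map.
move=> sE [aact aall]; split.
  move=> q; rewrite mem_cat => /orP[qpe|/mapP[j]].
    by rewrite old_edge //; exact: aact.
  rewrite mem_iota => jm ->.
  have js : (j - size vs < size s)%N by rewrite -szY; lia.
  have := new_edge js; rewrite subnKC; last by case/andP: jm.
  move=> ->; have := mem_nth fset0 js; rewrite {2}sE mem_filter.
  by case/andP.
move=> f fE fl' af; rewrite map_cat mem_cat; apply/orP.
have [fl|fl] := boolP (f \in l); last first.
  left; have /mapP[q qpe ->] := aall f fE fl af.
  by rewrite -old_edge //; apply: map_f.
right; have fs : f \in s.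
  rewrite sE !mem_filter af fl !andbT /=.
  by move: fl'; rewrite mem_filter fl andbT negbK.
have /(nthP fset0)[i im fi] := fs.
rewrite -fi -new_edge //; apply: map_f; apply: map_f.
by rewrite mem_iota szY leq_addr ltn_add2l.
Qed.

End Step.

Lemma drun_graph_tree {T : Type} (ev : {fset V} + L -> nat -> set T) K n l vs st pe B
    (act : pred {fset V}) w :
  (forall f a, ev (inl f) a w -> act f = a :> nat) ->
  graph_inv l vs st pe B -> graph_agree act l vs pe ->
  drun ev (graph_tree K n l vs st pe) w ->
  exists l' vs' pe' B', [/\ graph_inv l' vs' [::] pe' B', graph_agree act l' vs' pe' &
    drun ev (fin vs' pe') w].
Proof.
move=> evP; elim: n l vs st pe B => [|n IH] l vs [|p st] pe B inv agr //=.
- by exists l, vs, pe, B.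
- by exists l, vs, pe, B.
move=> /(drun_scan evP)[] /=; case: ifP => //= _ rw ok.
apply: IH rw.
  apply: graph_inv_step ok; [exact: inv|exact: filter_subseq].
apply: (graph_agree_step inv) agr => //; exact: filter_subseq.
Qed.

Lemma dfresh_graph_tree (DZ : set L) K n l vs st pe B :
  (forall l vs pe B, graph_inv l vs [::] pe B ->
     dfresh [set k | if k is inr z then DZ z else False] (fin vs pe)) ->
  graph_inv l vs st pe B ->
  dfresh [set k | match k with inl f => f \in l | inr z => DZ z end]
    (graph_tree K n l vs st pe).
Proof.
move=> hfin; have hfin' l' vs' pe' B' : graph_inv l' vs' [::] pe' B' ->
    dfresh [set k | match k with inl f => f \in l' | inr z => DZ z end] (fin vs' pe').
  by move=> /hfin; apply: dfreshS => -[].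
elim: n l vs st pe B => [|n IH] l vs [|p st] pe B inv //=; try exact: hfin' inv.
apply: dfresh_scan.
- exact: filter_uniq (gi_luniq inv).
- by move=> f; rewrite mem_filter => /andP[].
move=> s ss sok; rewrite cat0s; case: ifP => // _.
apply: dfreshS (IH _ _ _ _ _ (graph_inv_step inv ss sok)).
move=> [f|z] /=; last by [].
by rewrite !mem_filter => /andP[cf fl]; split => //; rewrite (negbTE cf).
Qed.

(** Error of the exploration in units of [eps]. In [K + 5] the summand [K] pays for the mean falling
    short of 1, 4 for the Poisson approximation and 1 for edges to stacked vertices; each carries a
    factor [K.+1 * Q]. [Q] bounds [B] plus the stack size, and a step adds at most 1 to [B] and [K]
    to the stack. *)
Fixpoint graph_err (K n Q : nat) : nat :=
  match n with
  | 0%N => 0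
  | n'.+1 => K.+1 * (K + 5) * Q + graph_err K n' (Q + K.+1)
  end.

Lemma dval_graph_tree (mu : {fset V} + L -> nat -> R) rho K n l vs st pe B Q :
  (forall f, f \in E -> mu (inl f) 0%N = 1 - x f) ->
  (forall f, f \in E -> mu (inl f) 1%N = x f) ->
  (forall m pe, 0 <= rho m pe <= 1) ->
  (forall l vs pe B, graph_inv l vs [::] pe B -> dval mu (fin vs pe) = rho (size vs) pe) ->
  graph_inv l vs st pe B -> (0 < Q)%N -> (B + size st <= Q)%N ->
  explore rho K n (size vs) st pe - (graph_err K n Q)%:R * eps <=
  dval mu (graph_tree K n l vs st pe).
Proof.
move=> mu0 mu1 rho01 hfin.
elim: n l vs st pe B Q => [|n IH] l vs [|p st] pe B Q inv Q0 BQ /=.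
- by rewrite mul0r subr0 (hfin _ _ _ _ inv).
- by rewrite mul0r subr0.
- by rewrite (hfin _ _ _ _ inv) lerBlDr lerDl mulr_ge0 // ler0n.
have [Q1 Q2] : (B + size st <= Q)%N /\ (size st <= Q)%N by move: BQ => /=; lia.
have Q3 k : (k <= K)%N -> (B.+1 + (k + size st) <= Q + K.+1)%N by move: BQ => /=; lia.
have Q4 : (0 < Q + K.+1)%N by rewrite addnS.
set c := at_ vs p; pose Ec : seq {fset V} := [seq f : {fset V} <- l | c \in f].
pose Bv k : R := if (k <= K)%N then explore rho K n (size vs + k) (iota (size vs) k ++ st)
  (pe ++ [seq (p, j) | j <- iota (size vs) k]) else 0.
have Bv01 k : 0 <= Bv k <= 1.
  by rewrite /Bv; case: ifP => _; [exact: explore_bounds|rewrite lexx ler01].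
set e0 := (graph_err K n (Q + K.+1))%:R * eps.
have e00 : 0 <= e0 by rewrite mulr_ge0 ?ler0n.
have EcE f : f \in Ec -> f \in E by rewrite mem_filter => /andP[_ /(gi_lE inv)].
have Ecc f : f \in Ec -> c \in f by rewrite mem_filter => /andP[].
have x01 f : f \in E -> 0 <= x f <= 1 by case: E_input => _; exact.
pose ok f := other c f \notin map (at_ vs) st.
set la := \sum_(f <- Ec | ok f) x f.
set s3 := \sum_(f <- Ec | ~~ ok f) x f.
set s2 := \sum_(f <- Ec | ok f) x f ^+ 2.
have uEc : uniq Ec by exact: filter_uniq (gi_luniq inv).
have la0 : 0 <= la.
  by rewrite /la big_seq_cond sumr_ge0 // => f /andP[/EcE/x01/andP[]].
have totE : la + s3 = \sum_(f <- l | c \in f) x f.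
  by rewrite -[RHS]big_filter [RHS](bigID ok) /=.
have tot1 : la + s3 <= 1.
  rewrite totE -(E_regular c).
  apply: sum_uniq_sub; [exact: gi_luniq inv|exact: fset_uniq|exact: gi_lE inv|].
  by move=> f /x01/andP[].
have tot0 : 1 - B%:R * eps <= la + s3.
  rewrite totE; apply: (gi_mass inv) => i im.
  move=> /eqP; rewrite (nth_uniq _ im _ (gi_uniq inv)); first by move=> /eqP ->; rewrite mem_head.
  by case/andP: (gi_stack inv) => _ /= /andP[].
have s30 : 0 <= s3.
  by rewrite /s3 big_seq_cond sumr_ge0 // => f /andP[/EcE/x01/andP[]].
(* Distinct edges at [c] have distinct far ends, and the ones rejected here end in the stack. *)
have s3le : s3 <= (size st)%:R * eps.
  apply: sum_le_size => //; first by move=> f /EcE/x_le.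
  rewrite -(size_map (other c)) -(size_map (at_ vs) st).
  apply: uniq_leq_size.
    rewrite map_inj_in_uniq; first exact: filter_uniq.
    move=> f g; rewrite !mem_filter => /andP[_ /andP[cf /(gi_lE inv) fE]].
    move=> /andP[_ /andP[cg /(gi_lE inv) gE]] fg.
    by rewrite (E_otherP fE cf).1 (E_otherP gE cg).1 fg.
  move=> y /mapP[f]; rewrite mem_filter => /andP[nok _] ->.
  by move: nok; rewrite negbK.
(* The sum of the squares is at most the largest mass times the total mass, which is at most 1. *)
have s2le : s2 <= eps.
  apply: (@le_trans _ _ (\sum_(f <- Ec | ok f) eps * x f)).
    rewrite /s2 big_seq_cond [leRHS]big_seq_cond; apply: ler_sum => f /andP[/EcE fE _].
    by rewrite expr2 ler_wpM2r ?x_le //; case/andP: (x01 f fE).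
  by rewrite -mulr_sumr ler_piMr //; rewrite -/la; lra.
have la1 : la <= 1 by lra.
have := @dval_scan R V L mu x K Bv e0 c (map (at_ vs) st) Ec [::]
  (fun Y => if (size Y <= K)%N then
     graph_tree K n [seq f <- l | c \notin f] (vs ++ Y)
       (iota (size vs) (size Y) ++ st)
       (pe ++ [seq (p, j) | j <- iota (size vs) (size Y)])
     else Leaf false)
  (fun f fEc => mu0 f (EcE f fEc)) (fun f fEc => mu1 f (EcE f fEc))
  (fun f fEc => x01 f (EcE f fEc)) Bv01 e00 la1.
rewrite -/la -/s2 -/s3 /= => h.
have {}h : pois_mean K Bv la 0 - 4 * K.+1%:R * s2 - K.+1%:R * s3 - e0 <=
    dval mu (scan c (map (at_ vs) st) Ec [::]
  (fun Y => if (size Y <= K)%N then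
     graph_tree K n [seq f <- l | c \notin f] (vs ++ Y)
       (iota (size vs) (size Y) ++ st)
       (pe ++ [seq (p, j) | j <- iota (size vs) (size Y)])
     else Leaf false)).
  apply: h => s ss sok; rewrite add0n ?cat0s size_map /Bv.
  case: ifP => sK; last by rewrite /= sub0r oppr_le0.
  have inv' := graph_inv_step inv ss sok; rewrite size_map in inv'.
  have := IH _ _ _ _ _ (Q + K.+1)%N inv'; rewrite !size_cat size_iota size_map.
  by apply => //; exact: Q3.
apply: le_trans h.
have -> : \sum_(0 <= k < K.+1) poisson_pmf 1 k * explore rho K n (size vs + k)
    (iota (size vs) k ++ st) (pe ++ [seq (p, j) | j <- iota (size vs) k]) =
    pois_mean K Bv 1 0.
  rewrite /pois_mean; apply: eq_big_nat => k /= kK.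
  by rewrite pois1 add0n /Bv (_ : (k <= K)%N).
have la01 : 0 <= la <= 1 by rewrite la0 la1.
have pm := pois_mean_ge K 0 Bv01 la01.
(* The mean falls short of 1 by the mass of the edges already queried, at most [B * eps], and of
   those to stacked vertices. *)
have etale : 1 - la <= Q%:R * eps.
  apply: (@le_trans _ _ ((B + size st)%:R * eps)).
    by rewrite natrD mulrDl; lra.
  by rewrite ler_wpM2r // ler_nat.
have epsQ : eps <= Q%:R * eps by rewrite ler_peMl // ler1n.
have s3Q : s3 <= Q%:R * eps.
  by apply: le_trans s3le _; rewrite ler_wpM2r // ler_nat.
have K0 : 0 <= K.+1%:R :> R by rewrite ler0n.
have KK0 : 0 <= K.+1%:R * K%:R :> R by rewrite mulr_ge0 ?ler0n.
have b1 := ler_wpM2l KK0 etale.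
have b2 := ler_wpM2l K0 (le_trans s2le epsQ).
have b3 := ler_wpM2l K0 s3Q.
rewrite natrD !natrM natrD mulrDl -/e0.
set k1 : R := K.+1%:R in b1 b2 b3 pm K0 KK0 *; set q : R := Q%:R * eps in b1 b2 b3 *.
have -> : k1 * (K%:R + 5) * Q%:R * eps = k1 * K%:R * q + k1 * q * 5.
  by rewrite /q; ring.
lra.
Qed.

End GraphExploration.

Lemma eq_foldl_greedy (V : choiceType) (act act' : pred {fset V}) (s M : seq {fset V}) :
  {in s, act =1 act'} ->
  foldl (greedy_step act) M s = foldl (greedy_step act') M s.
Proof.
elim: s M => //= f s IH M h; rewrite /greedy_step h ?mem_head //.
by apply: IH => g gs; apply: h; rewrite inE gs orbT.
Qed.

Lemma finite_finType (V : finType) : finite_set [set: V].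
Proof.
by apply: (@sub_finite_set _ _ [set` enum V]) => [v _ /=|]; [rewrite mem_enum|exact: finite_seq].
Qed.

(** * The lower bound in the graph *)

Section GraphSide.
Context {R : realType} {V : finType} (o : ordering).
Variables (E : {fset {fset V}}) (x : {fset V} -> R) (eps : R).
Hypotheses (E_input : is_input E x) (E_regular : one_regular E x).
Hypothesis x_le : forall f, f \in E -> x f <= eps.
Context {d : measure_display} {T : measurableType d} (P : probability T R).
Variables (X : {fset V} -> {RV P >-> bool}) (tau : T -> {fset V} -> R).
Hypothesis model : crs_model o E x X tau.
Variable e : {fset V}.
Hypothesis eE : e \in E.

Let matched := [set w | e \in greedy_crs (tau w) (fun f => X f w) E].

Lemma input_edge_pair f : [set` E] f -> exists a b, f = [fset a; b]%fset.
Proof.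
move=> fE; have f2 : #|` f| = 2%N by case: E_input => h _; exact: h.
have /fset0Pn[a af] : f != fset0 by rewrite -cardfs_gt0 f2.
by exists a, (other a f); case: (otherP f2 af).
Qed.

Lemma measurable_matched : measurable matched.
Proof.
have [_ ro] := model.
have [Z [DZ [_ _ _ _ [A [mA leA]]]]] := random_orderP input_edge_pair ro.
pose b (k : {fset V} + {fset V} * {fset V}) w :=
  match k with inl f => X f w | inr fg => `[< A fg w >] end.
apply: (@measurable_bools _ _ _ ([seq inl f | f <- E] ++
  [seq inr fg | fg <- [seq (f, g) | f <- E, g <- E]]) b) => [[f|fg] _|w w' ww'] /=.
- rewrite (_ : [set _ | _] = X f @^-1` [set true]) //; exact: measurable_funPTI.
- rewrite (_ : [set _ | _] = A fg) //.
  by apply/seteqP; split => w /asboolP.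
suff -> : greedy_crs (tau w) (fun f => X f w) E = greedy_crs (tau w') (fun f => X f w') E.
  by [].
rewrite /greedy_crs.
have -> : sort (fun f g => tau w f <= tau w g) E = sort (fun f g => tau w' f <= tau w' g) E.
  apply: (@eq_in_sort _ (mem E)); last exact/allP.
  have fV := finite_finType V.
  move=> f g fE gE; rewrite (leA w) ?(leA w') //.
  by apply: (ww' (inr (f, g))); rewrite mem_cat map_f ?orbT //; apply: allpairs_f.
apply: eq_foldl_greedy => f; rewrite mem_sort => fE.
by apply: (ww' (inl f)); rewrite mem_cat map_f.
Qed.

Lemma prob_active : fine (P [set w | X e w = true]) = x e.
Proof. by have [-> //] := model. Qed.

Lemma measurable_active f : measurable [set w | X f w = true].
Proof. by rewrite (_ : [set _ | _] = X f @^-1` [set true]) //; exact: measurable_funPTI. Qed.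

(** The activity of [e] is imposed as an observation beforehand, whence the factor [x e], which
    division turns into a conditional probability. The 3 is the initial bound on [B] plus the stack
    size: 1 for [e], absent from the unqueried edges, and 2 for its endpoints. *)
Lemma graph_lower_bound n b K l : 0 <= eps ->
  x e * (explore (root_val o n b) K l 2 [:: 0; 1]%N [:: (0, 1)%N]
         - (graph_err K l 3)%:R * eps) <=
  fine (P ((if b then matched else ~` matched) `&` [set w | X e w = true])).
Proof.
move=> eps0; have [Xx ro] := model.
have [Z [DZ [Zu Zind DZlab tauZ _]]] := random_orderP input_edge_pair ro.
have x01 f : f \in E -> 0 <= x f <= 1 by case: E_input => _; exact.
have e2 : #|` e| = 2%N by case: E_input => h _; exact: h.
have /fset0Pn[u ue] : e != fset0 by rewrite -cardfs_gt0 e2.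
have [euv uv] := otherP e2 ue; set v := other u e in euv uv.
pose fin vs pe : dtree ({fset V} + label o V) :=
  root_tree o n b (nth u vs) (size vs) pe.
pose enc := nat_of_bool.
pose ev := obs_event X enc Z n.
pose mu k a := fine (P (ev k a)).
pose l0 := [seq f <- E | f != e].
have inv0 : graph_inv E x eps e u l0 [:: u; v] [:: 0; 1]%N [:: (0, 1)%N] 1.
  split => //=.
  - by rewrite inE eq_sym uv.
  - by rewrite filter_uniq // fset_uniq.
  - by move=> f; rewrite mem_filter => /andP[].
  - by rewrite mem_filter eqxx.
  - by move=> f [|[|i]].
  - by move=> q; rewrite inE => /eqP ->; rewrite /edge_of /= -euv.
  - move=> c _; rewrite mul1r -(E_regular c) big_filter_cond /=.
    rewrite lerBlDr (bigID (fun f => f != e)) /=.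
    have -> : \sum_(f <- E | (c \in f) && (f != e)) x f =
              \sum_(f <- E | (f != e) && (c \in f)) x f.
      by apply: eq_bigl => f; rewrite andbC.
    rewrite lerD2l -[leRHS]mul1r -[1]/(1%:R).
    apply: sum_le_size => //.
    apply: (@uniq_leq_size _ _ [:: e]); first by rewrite filter_uniq // fset_uniq.
    by move=> f; rewrite mem_filter negbK inE => /andP[/andP[_ ->]].
have injv l' vs pe B : graph_inv E x eps e u l' vs [::] pe B -> forall i j,
    (i < size vs)%N -> (j < size vs)%N -> nth u vs i = nth u vs j -> i = j.
  by move=> inv i j im jm /eqP; rewrite (nth_uniq _ _ _ (gi_uniq inv)) // => /eqP.
have DZl l' vs pe B : graph_inv E x eps e u l' vs [::] pe B -> forall i,
    (i < nlabels o (size vs))%N -> DZ (label_of o (nth u vs) pe i).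
  move=> inv i im; apply: (DZlab _ (size vs)) => //; first exact: gi_pairs inv.
  by move=> p ppe; exact: gi_edge inv _ ppe.
have mu1 f : f \in E -> mu (inl f) 1%N = x f.
  move=> fE; rewrite /mu /ev /= (_ : [set _ | _] = [set w | X f w = true]) ?Xx //.
  by apply/seteqP; split => w /=; rewrite /enc; case: (X f w).
have mu0 f : f \in E -> mu (inl f) 0%N = 1 - x f.
  move=> fE; rewrite /mu /ev /= (_ : [set _ | _] = ~` [set w | X f w = true]).
    by rewrite probability_setC ?Xx //; exact: measurable_active.
  by apply/seteqP; split => w /=; rewrite /enc; case: (X f w).
have dv : explore (root_val o n b) K l 2 [:: 0; 1]%N [:: (0, 1)%N]
    - (graph_err K l 3)%:R * eps <=
    dval mu (graph_tree u fin K l l0 [:: u; v] [:: 0; 1]%N [:: (0, 1)%N]).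
  apply: (dval_graph_tree E_input E_regular x_le eps0 K l mu0 mu1 _ _ inv0) => //.
    by move=> m pe; exact: label_val_bounds.
  move=> l' vs pe B inv; apply: dval_root_tree => i im; apply: Zu.
  exact: DZl inv i im.
have /andP[xe0 _] := x01 e eE.
apply: le_trans (ler_wpM2l xe0 dv) _.
have := @obs_lower_bound R d T P {fset V} (label o V) _ _ X enc Z n [set` E] DZ _ Zind
  (if b then matched else ~` matched)
  (graph_tree u fin K l l0 [:: u; v] [:: 0; 1]%N [:: (0, 1)%N])
  [set k | match k with inl f => f \in l0 | inr z => DZ z end]
  [fset (inl e : {fset V} + label o V)]%fset (fun=> 1%N).
rewrite big_seq_fset1 -/ev -/(mu (inl e) 1%N) mu1 //.
have -> : \bigcap_(k in [set` [fset (inl e : {fset V} + label o V)]%fset]) ev k 1%N =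
    [set w | X e w = true].
  apply/seteqP; split => w /=.
    move=> /(_ (inl e)) /=; rewrite inE eqxx => /(_ isT).
    by rewrite /enc; case: (X e w).
  by move=> Xe k /=; rewrite inE => /eqP ->; rewrite /= Xe.
apply.
- by move=> a.
- by case: (b); [|apply: measurableC]; exact: measurable_matched.
- by move=> [f|z] //=; rewrite mem_filter => /andP[].
- by move=> k /=; rewrite inE => /eqP ->.
- by move=> k; rewrite inE => /eqP -> /=; rewrite mem_filter eqxx.
- apply: (dfresh_graph_tree E_input x_le eps0 _ _ _ inv0) => l' vs pe B inv.
  apply: dfresh_root_tree; [exact: injv inv|exact: gi_pairs inv|].
  exact: DZl inv.
move=> w Jw rw0.
have Xew : X e w = true.
  by have := Jw (inl e); rewrite inE eqxx => /(_ isT) /=; rewrite /enc; case: (X e w).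
have evP f a : ev (inl f) a w -> X f w = a :> nat by [].
have agr0 : graph_agree E u (fun f => X f w) l0 [:: u; v] [:: (0, 1)%N].
  split; first by move=> q; rewrite inE => /eqP ->; rewrite /edge_of /= -euv Xew.
  move=> f fE; rewrite mem_filter fE andbT negbK => /eqP -> _.
  by rewrite inE /edge_of /= -euv.
have [l' [vs [pe [B [inv agr rw]]]]] :=
  drun_graph_tree E_input x_le eps0 evP inv0 agr0 rw0.
have gE : (e \in greedy_crs (tau w) (fun f => X f w) E) = b.
  rewrite -(gi_rootE inv).
  apply: (drun_root_tree (phi := nth u vs) (m := size vs) (pe := pe) _ _ _ _ _ _ rw).
  - exact: injv inv.
  - exact: gi_pairs inv.
  - exact: gi_root inv.
  - by move=> p ppe; split; [exact: (gi_edge inv ppe)|exact: (ga_act agr ppe)].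
  (* With an empty stack no unqueried edge meets a discovered vertex, so every active edge touching
     the component was queried and recorded in [pe]. *)
  - move=> f p a fE Xf ppe af; rewrite /edge_of !inE => ap.
    apply: (ga_all agr) => //; apply/negP => fl.
    have [/allP ok _] := gi_pairs inv.
    have /andP[p12 p2] := ok _ ppe; have p1 := ltn_trans p12 p2.
    case/orP: ap => /eqP ap; rewrite ap in af.
      by have := gi_open inv fl p1 af; rewrite in_nil.
    by have := gi_open inv fl p2 af; rewrite in_nil.
  - apply: (tauZ w (nth u vs) (size vs) pe) => //.
    + exact: gi_pairs inv.
    + by move=> p ppe; exact: gi_edge inv _ ppe.
    + exact: finite_finType.
by rewrite /matched; case: (b) gE => /= ->.
Qed.

End GraphSide.

(** * The two-sided estimate *)

Lemma theorem12_eps_delta (R : realType) (o : ordering)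
    (dT : measure_display) (OmegaT : measurableType dT)
    (PT : probability OmegaT R) (N : node -> {RV PT >-> nat})
    (tauT : OmegaT -> {fset node} -> R) (hT : tree_model o N tauT) (de : R) : 0 < de ->
  exists2 eps0 : R, 0 < eps0 &
    forall (V : finType) (E : {fset {fset V}}) (x : {fset V} -> R) (eps : R),
      eps <= eps0 ->
      is_input E x -> one_regular E x -> (forall e, e \in E -> x e <= eps) ->
    forall (d : measure_display) (Omega : measurableType d)
      (P : probability Omega R) (X : {fset V} -> {RV P >-> bool})
      (tau : Omega -> {fset V} -> R),
      crs_model o E x X tau ->
    forall e, e \in E -> 0 < x e ->
      `| cond_pr P
           [set w | e \in greedy_crs (tau w) (fun e' => X e' w) E]
           [set w | X e w = true]
         - fine (PT [set w | root_edge_matched (fun a => N a w) (tauT w)]) |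
      <= de.
Proof.
move=> de0; have de40 : 0 < de / 4 by rewrite divr_gt0.
have [K [L mKL]] := mass_near1 de40.
(* The largest possible number of vertices: two roots, then [L] steps with at most [K] children
   each. One quarter of [de] pays for discarded trees, one for label collisions and one for the
   graph error. *)
pose Mx := (2 + K * L)%N.
have [n n0 nMx] : exists2 n, (0 < n)%N & (Mx * Mx)%:R / n%:R <= de / 4 :> R.
  pose y : R := (Mx * Mx)%:R / (de / 4).
  have y0 : 0 <= y by rewrite divr_ge0 ?ler0n // divr_ge0 // ltW.
  exists (Num.bound y).+1 => //.
  rewrite ler_pdivrMr ?ltr0n // mulrC -ler_pdivrMr ?divr_gt0 //.
  have := archi_boundP y0; rewrite -/y -natr1; lra.
pose C : R := (graph_err K L 3)%:R.
have C0 : 0 <= C by rewrite ler0n.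
pose eps0 := de / 4 / (C + 1).
have eps00 : 0 < eps0 by rewrite /eps0 divr_gt0 ?divr_gt0 //; lra.
have Ceps : C * eps0 <= de / 4.
  rewrite /eps0 mulrCA ler_piMr ?(ltW de40) //.
  by rewrite ler_pdivrMr; lra.
exists eps0 => // V E x eps epsle Ein Ereg xle d Omega P X tau model e eE xe.
have xle0 f : f \in E -> x f <= eps0 by move=> fE; apply: le_trans (xle f fE) epsle.
pose s b := explore (R := R) (root_val o n b) K L 2 [:: 0; 1]%N [:: (0, 1)%N].
have ss : 1 - de / 2 <= s true + s false.
  rewrite /s exploreD.
  have := @explore_ge_mass R (fun m pe => root_val o n true m pe + root_val o n false m pe)
    K L 2 [:: 0; 1]%N [:: (0, 1)%N] (de / 4) Mx.
  have h m pe : (m <= Mx)%N -> 1 - de / 4 <=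
      root_val o n true m pe + root_val o n false m pe :> R.
    by move=> mM; apply: le_trans (root_valD o pe n0 mM); rewrite lerD2l lerN2.
  move=> /(_ (ltW de40) h (leqnn _)) /=; lra.
set A := [set w | X e w = true]; set M := [set w | e \in _].
set MT := [set w | root_edge_matched _ _].
have T1 : s true <= fine (PT MT) := tree_lower_bound hT n true K L.
have T0 : s false <= fine (PT (~` MT)) := tree_lower_bound hT n false K L.
have mT : measurable MT := measurable_root_edge_matched hT.
have G1 : x e * (s true - C * eps0) <= fine (P (M `&` A)) :=
  graph_lower_bound Ein Ereg xle0 model eE n true K L (ltW eps00).
have G0 : x e * (s false - C * eps0) <= fine (P (~` M `&` A)) :=
  graph_lower_bound Ein Ereg xle0 model eE n false K L (ltW eps00).
have mM : measurable M := measurable_matched Ein model e.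
have mA : measurable A := measurable_active X e.
rewrite probability_setC // -(fineK_probability PT mT) -EFinB /= in T0.
have PA : fine (P A) = x e := prob_active model eE.
have := fine_probability_split P mA mM.
rewrite /cond_pr PA setDE [A `&` ~` M]setIC [A `&` M]setIC => PAM.
have c1 : s true - C * eps0 <= fine (P (M `&` A)) / x e by rewrite ler_pdivlMr // mulrC.
have c0 : s false - C * eps0 <= fine (P (~` M `&` A)) / x e by rewrite ler_pdivlMr // mulrC.
have c : fine (P (~` M `&` A)) / x e + fine (P (M `&` A)) / x e = 1.
  by rewrite -mulrDl -PAM mulfV // lt0r_neq0.
(* The tree probability lies between [s true] and [1 - s false], an interval of length at most
   [de / 2]; the conditional probability lies in the same interval widened by [de / 4] on each
   side. *)
by rewrite ler_norml; apply/andP; split; lra.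
Qed.

(** With no explicit rate at hand, [f] is the infimum of all the bounds valid uniformly over the
    inputs of mass at most [eps]; being an infimum of lower-bounded valid constants, it is still a
    bound. *)
Theorem theorem12 (R : realType) (o : ordering)
    (dT : measure_display) (OmegaT : measurableType dT)
    (PT : probability OmegaT R) (N : node -> {RV PT >-> nat})
    (tauT : OmegaT -> {fset node} -> R) (hT : tree_model o N tauT) :
  exists f : R -> R, f eps @[eps --> 0^'] --> 0 /\
    forall (V : finType) (E : {fset {fset V}}) (x : {fset V} -> R) (eps : R),
      is_input E x -> one_regular E x -> (forall e, e \in E -> x e <= eps) ->
    forall (d : measure_display) (Omega : measurableType d)
      (P : probability Omega R) (X : {fset V} -> {RV P >-> bool})
      (tau : Omega -> {fset V} -> R),
      crs_model o E x X tau ->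
    forall e, e \in E -> 0 < x e ->
      `| cond_pr P
           [set w | e \in greedy_crs (tau w) (fun e' => X e' w) E]
           [set w | X e w = true]
         - fine (PT [set w | root_edge_matched (fun a => N a w) (tauT w)]) |
      <= f eps.
Proof.
pose gap (V : finType) (E : {fset {fset V}}) d (Omega : measurableType d)
    (P : probability Omega R) (X : {fset V} -> {RV P >-> bool})
    (tau : Omega -> {fset V} -> R) e :=
  `| cond_pr P [set w | e \in greedy_crs (tau w) (fun e' => X e' w) E]
       [set w | X e w = true]
     - fine (PT [set w | root_edge_matched (fun a => N a w) (tauT w)]) |.
pose bound eps c :=
  forall (V : finType) (E : {fset {fset V}}) (x : {fset V} -> R),
    is_input E x -> one_regular E x -> (forall e, e \in E -> x e <= eps) ->
  forall (d : measure_display) (Omega : measurableType d)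
    (P : probability Omega R) (X : {fset V} -> {RV P >-> bool})
    (tau : Omega -> {fset V} -> R), crs_model o E x X tau ->
  forall e, e \in E -> 0 < x e -> gap V E d Omega P X tau e <= c.
(* Requiring [0 <= c] keeps the set bounded below even when no input satisfies the mass bound, as
   may happen for negative [eps], where every [c] is vacuously valid. *)
pose S eps := [set c | 0 <= c /\ bound eps c].
have S1 eps : S eps 1.
  split=> // V E x Ein Ereg xle d Omega P X tau model e eE xe.
  rewrite /gap /cond_pr (prob_active model eE).
  have mG := measurable_matched Ein model e; have mA := measurable_active X e.
  have mT := measurable_root_edge_matched hT.
  set MT := fine (PT _); set g := fine (P _).
  have MT01 : 0 <= MT <= 1.
    by rewrite fine_probability_ge0 -lee_fin fineK_probability // probability_le1.
  have g01 : 0 <= g / x e <= 1.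
    rewrite divr_ge0 ?fine_probability_ge0 ?(ltW xe) //= ler_pdivrMr // mul1r.
    rewrite -(prob_active model eE); apply: le_fine_probability => //.
    exact: measurableI.
  by rewrite ler_norml; apply/andP; split; lra.
have Slb eps : lbound (S eps) 0 by move=> c [].
exists (fun eps => inf (S eps)); split; last first.
  move=> V E x eps Ein Ereg xle d Omega P X tau model e eE xe.
  apply: lb_le_inf; first by exists 1.
  by move=> c [_ bnd]; exact: (bnd V E x Ein Ereg xle d Omega P X tau model e eE xe).
apply/cvgrPdist_le => de de0.
have [eps0 eps00 H] := theorem12_eps_delta hT de0.
(* The punctured neighbourhood contains negative [eps] too, so the threshold is compared with the
   absolute value. *)
exists eps0 => //= eps /=; rewrite sub0r normrN => epsle _.
have Sde : S eps de.
  split; first exact: ltW.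
  move=> V E x Ein Ereg xle; apply: (H V E x eps) => //.
  exact: le_trans (ler_norm _) (ltW epsle).
rewrite sub0r normrN ger0_norm; last by apply: lb_le_inf; [exists 1|].
by apply: ge_inf => //; exists 0.
Qed.
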